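(* Let $f:\mathbb{C}\to\mathbb{C}$ be an entire transcendental function. Then its topological entropy (in the sense of Bowen, computed on the space $X=\mathbb{C}$) satisfies $h(f)=\infty$.
   Context: Topological entropy (Bowen's definition for arbitrary self-maps of topological spaces). Let $X$ be a topological space, $f:X\to X$ a map, $f^0=\mathrm{id}$, $f^n=f\circ f^{n-1}$, and let $\xi$ be a cover of $X$. For $C\subseteq X$ write $C\prec\xi$ if there is $E\in\xi$ with $C\subseteq E$. Put $$N_{f,\xi}(C)=\sup\{k\in\mathbb{N}_0 : f^\ell(C)\prec\xi \text{ for } \ell=0,\dots,k\}$$ if $C\prec\xi$, and $N_{f,\xi}(C)=0$ otherwise. Put $D_{f,\xi}(C)=\exp(-N_{f,\xi}(C))$ with $\exp(-\infty)=0$. For $A\subseteq X$ and $s,\delta\in(0,\infty)$ let $$h^s_{\xi,\delta}(f,A)=\inf\Big\{\sum_{j=1}^\infty D_{f,\xi}(C_j)^s : A\subseteq\bigcup_{j\in\mathbb{N}}C_j,\ D_{f,\xi}(C_j)\le\delta \text{ for all } j\in\mathbb{N}\Big\},$$ $h^s_\xi(f,A)=\sup_{\delta>0}h^s_{\xi,\delta}(f,A)=\lim_{\delta\to0}h^s_{\xi,\delta}(f,A)$, and $h_\xi(f,A)=\inf\{s\in(0,\infty): h^s_\xi(f,A)=0\}$. The topological entropy of $f$ on $A$ is $h(f,A)=\sup\{h_\xi(f,A):\xi\text{ a finite open cover of }X\}$, and the topological entropy of $f$ is $h(f)=h(f,X)$. *)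

(* Defs.v *)
From HB Require Import structures.
From mathcomp Require Import all_boot all_order all_algebra.
From mathcomp Require Import all_classical all_reals all_analysis.
From mathcomp Require Export complex.

Set Implicit Arguments.
Unset Strict Implicit.
Unset Printing Implicit Defensive.

Import Order.TTheory GRing.Theory Num.Theory.
Import numFieldNormedType.Exports.

Local Open Scope classical_set_scope.
Local Open Scope ring_scope.
Local Open Scope complex_scope.
Local Open Scope ereal_scope.

(* C \prec xi *)
Definition subordinate (X : Type) (C : set X) (xi : set (set X)) : Prop :=
  exists2 E, xi E & C `<=` E.

(* N_{f,xi}(C), with values in [0, +oo] *)
Definition escape_time (R : realType) (X : Type) (f : X -> X)
    (xi : set (set X)) (C : set X) : \bar R :=
  if `[< subordinate C xi >] then
    ereal_sup [set (k%:R : R)%:E | k in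
      [set k : nat | forall l, (l <= k)%N -> subordinate (iter l f @` C) xi]]
  else 0.

(* D_{f,xi}(C); expeR satisfies expeR -oo = 0 *)
Definition bowen_diam (R : realType) (X : Type) (f : X -> X)
    (xi : set (set X)) (C : set X) : \bar R :=
  expeR (- escape_time R f xi C).

(* h^s_{xi,delta}(f,A); the covering families are indexed from 0 *)
Definition entropy_premeasure (R : realType) (X : Type) (f : X -> X)
    (A : set X) (xi : set (set X)) (s delta : R) : \bar R :=
  ereal_inf [set \sum_(0 <= j <oo) (bowen_diam R f xi (C j)) `^ s | C in
    [set C : nat -> set X | A `<=` \bigcup_j C j /\
                            forall j, bowen_diam R f xi (C j) <= delta%:E]].

(* h^s_xi(f,A) *)
Definition entropy_measure (R : realType) (X : Type) (f : X -> X)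
    (A : set X) (xi : set (set X)) (s : R) : \bar R :=
  ereal_sup [set entropy_premeasure f A xi s delta |
             delta in [set delta : R | (0 < delta)%R]].

(* h_xi(f,A); the infimum of the empty set is +oo *)
Definition cover_entropy (R : realType) (X : Type) (f : X -> X)
    (A : set X) (xi : set (set X)) : \bar R :=
  ereal_inf [set s%:E | s in
    [set s : R | (0 < s)%R /\ entropy_measure f A xi s = 0]].

Definition finite_open_cover (X : topologicalType) (xi : set (set X)) : Prop :=
  [/\ finite_set xi, (forall E, xi E -> open E) & cover xi id = setT].

(* h(f,A) *)
Definition entropy_on (R : realType) (X : topologicalType) (f : X -> X)
    (A : set X) : \bar R :=
  ereal_sup [set cover_entropy R f A xi | xi in @finite_open_cover X].

Definition topological_entropy (R : realType) (X : topologicalType)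
    (f : X -> X) : \bar R :=
  entropy_on R f setT.

(* R[i]^o is R[i] as a normed space over itself, with the topology of the
   modulus.  Scalars range over R[i], so derivability in the direction 1 is
   complex differentiability. *)
Definition entire (R : realType) (f : R[i]^o -> R[i]^o) : Prop :=
  forall z : R[i]^o, derivable f z 1%R.

(* For entire functions, transcendental means not a polynomial. *)
Definition transcendental_entire (R : realType) (f : R[i]^o -> R[i]^o) : Prop :=
  entire f /\ ~ exists p : {poly R[i]}, forall z : R[i], f z = p.[z]%R.

(* Main.v *)
Require Import Defs.
From mathcomp Require Import all_boot all_order all_algebra.
From mathcomp Require Import all_classical all_reals all_analysis.
From mathcomp Require Import ring lra zify.
Import numFieldNormedType.Exports.
Import Order.TTheory GRing.Theory Num.Theory.
Local Open Scope classical_set_scope.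
Local Open Scope ring_scope.
Local Open Scope complex_scope.

(** Bowen's entropy with finite open covers sees the behaviour at infinity of a
    noncompact space, and a map with enough escaping orbits has infinite
    entropy. Suppose that open sets [G x n], for [x] in [[0, 1]] and [n] a time,
    increase strictly with [x], that all of them at time [n] lie inside all of
    them at time [n + 1], that they exhaust the space, and that every [x] has an
    orbit whose [n]-th point lies on the frontier of [G x n]. Cut the region
    swept at time [n] into [N ^ n] layers according to the [N]-adic expansion
    of [x], and color the layers cyclically with [4 * N] colors. As the layers
    are locally finite, the colors define a finite open cover. A set all of
    whose images up to time [k] are subordinate to this cover contains points of
    orbits whose parameters are within [2 / N ^+ k] of each other, so Lebesgue
    measure of the parameters bounds the [s]-dimensional premeasure below for
    [s <= ln N], and the entropy is at least [ln N], for every [N]. This is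
    [entropy_of_layers].

    For an entire function [f] that is not affine, start with discs of radius
    [t] in [[r, 2 * r]] and alternate applying [f] and filling holes ([hull]).
    The frontier of each set lies in the image of the previous frontier, because
    [f] is open ([open_mapping]); following frontiers backwards and using
    compactness gives the orbits ([frontier_orbit]). That the sets increase
    with time and exhaust the plane follows from one fact: for large [rho] the
    filled image of the disc of radius [rho] contains the disc of radius
    [2 * rho] ([missed_set_far]). Otherwise an unbounded connected set [A]
    containing a point [a] of modulus less than [2 * rho] misses the image. A
    logarithm of [f - a] exists on the disc ([log_branch]) and cannot cover a
    disc of radius larger than [pi], since [A] meets every circle about [a]. By
    the theorem of Bloch and Landau ([bloch_landau]) it is bounded by a constant
    on a smaller disc, up to its value at 0, so [f] is [O(rho)] there. If this
    happened for arbitrarily large [rho], then [f] would be affine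
    ([entire_affine]).

    The function theory rests on Goursat's theorem ([goursat]). Applied to
    [f] composed with the exponential, it shows that circle averages do not
    depend on the radius, whence the mean value bound ([mean_bound]) and
    Cauchy's estimate for the derivative ([cauchy_estimate]); all other facts
    are drawn from these two inequalities. *)

Set Implicit Arguments.
Unset Strict Implicit.
Unset Printing Implicit Defensive.

(** * The modulus and complex differentiation *)

(** The first-order expansion in which all derivatives below are computed, for
    real and complex variables alike. *)
Lemma is_derive1P (K : numFieldType) (f : K^o -> K^o) (z l : K) :
  is_derive (z : K^o) 1 f l <-> forall e, 0 < e -> exists2 d, 0 < d &
  forall k, `|k| < d -> `|f (z + k) - f z - l * k| <= e * `|k|.
Proof.
split=> [[df <-] e e0|H].
  have /cvgrPdist_lt/(_ _ e0)[d d0 H] := df.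
  exists d => // k kd.
  have [->|k0] := eqVneq k 0.
    by rewrite addr0 subrr mulr0 subrr normr0 mulr0.
  have := H k; rewrite /ball_/= sub0r normrN => /(_ kd k0) {}H.
  set D := 'D_ _ _ _ in H *.
  have -> : f (z + k) - f z - D * k
    = - k * (D - k^-1 *: (f (k *: (1 : K^o) + z) - f z)).
    by rewrite /GRing.scale/= mulr1 (addrC k); move: (f (z + k)) => y; field.
  by rewrite normrM normrN mulrC ler_wpM2r// ltW.
suff L : (fun h : K^o => h^-1 *: (f (h *: 1 + z) - f z)) @ 0^' --> (l : K^o).
  apply: DeriveDef; first by apply/cvg_ex; exists l.
  exact/cvg_lim.
apply/cvgrPdist_le => e /H[d d0 {}H].
exists d => // k; rewrite /ball_/= sub0r normrN => /H {}H k0.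
have -> : l - k^-1 *: (f (k *: (1 : K^o) + z) - f z)
    = - k^-1 * (f (z + k) - f z - l * k).
  by rewrite /GRing.scale/= mulr1 (addrC k); move: (f (z + k)) => y; field.
by rewrite normrM normrN normfV mulrC ler_pdivrMr// normr_gt0.
Qed.

Section Modulus.
Context {R : realType}.
Local Notation C := R[i].
Implicit Types (x y z w k l : C) (e d r : R).

Definition cmod (z : C) : R := ComplexField.Normc.normc z.
Arguments cmod : simpl never.

Lemma normC_cmod z : `|z| = (cmod z)%:C.
Proof. by case: z. Qed.

Lemma cmodE z : cmod z = Num.sqrt (complex.Re z ^+ 2 + complex.Im z ^+ 2).
Proof. by case: z. Qed.

Lemma cmod_ge0 z : 0 <= cmod z.
Proof. by rewrite cmodE sqrtr_ge0. Qed.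

Lemma cmod0 : cmod 0 = 0.
Proof. exact: ComplexField.Normc.normc0. Qed.

Lemma cmod1 : cmod 1 = 1.
Proof. exact: ComplexField.Normc.normc1. Qed.

Lemma cmodM z w : cmod (z * w) = cmod z * cmod w.
Proof. exact: ComplexField.Normc.normcM. Qed.

Lemma cmodV z : cmod z^-1 = (cmod z)^-1.
Proof. exact: ComplexField.Normc.normcV. Qed.

Lemma cmodX z n : cmod (z ^+ n) = cmod z ^+ n.
Proof. by elim: n => [|n IH]; rewrite ?expr0 ?cmod1// !exprS cmodM IH. Qed.

Lemma cmodN z : cmod (- z) = cmod z.
Proof. exact: normcN. Qed.

Lemma cmodB z w : cmod (z - w) = cmod (w - z).
Proof. by rewrite -cmodN opprB. Qed.

Lemma cmodD z w : cmod (z + w) <= cmod z + cmod w.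
Proof. exact: le_normcD. Qed.

Lemma cmodBD z w : cmod (z - w) <= cmod z + cmod w.
Proof. by rewrite -(cmodN w) cmodD. Qed.

Lemma cmod_tri z w t : cmod (z - t) <= cmod (z - w) + cmod (w - t).
Proof. by rewrite -[z - t](subrKA w) cmodD. Qed.

Lemma cmod_sub_ge z w : cmod z - cmod w <= cmod (z - w).
Proof. have := cmodD (z - w) w; rewrite subrK; lra. Qed.

Lemma cmod_eq0 z : (cmod z == 0) = (z == 0).
Proof.
apply/eqP/eqP => [|->]; last exact: cmod0.
exact: ComplexField.Normc.eq0_normc.
Qed.

Lemma cmod_gt0 z : (0 < cmod z) = (z != 0).
Proof. by rewrite lt_def cmod_eq0 cmod_ge0 andbT. Qed.

Lemma cmod_real (x : R) : cmod x%:C = `|x|.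
Proof. by rewrite cmodE /= expr0n /= addr0 sqrtr_sqr. Qed.

Lemma Re_le_cmod z : `|complex.Re z| <= cmod z.
Proof. by rewrite cmodE -sqrtr_sqr ler_wsqrtr// lerDl sqr_ge0. Qed.

Lemma Im_le_cmod z : `|complex.Im z| <= cmod z.
Proof. by rewrite cmodE -sqrtr_sqr ler_wsqrtr// lerDr sqr_ge0. Qed.

Lemma cmod_le_ReIm z : cmod z <= `|complex.Re z| + `|complex.Im z|.
Proof.
have := cmodD (complex.Re z)%:C ('i%C * (complex.Im z)%:C).
rewrite -complexE cmodM !cmod_real.
by rewrite [cmod 'i%C]cmodE /= expr0n expr1n add0r sqrtr1 mul1r.
Qed.

Lemma nbhsC (z : C^o) (A : set C^o) :
  nbhs z A <-> exists2 e, 0 < e & forall y, cmod (y - z) < e -> A y.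
Proof.
split=> [/nbhs_ballP[e /= e0 zeA]|[e e0 zeA]].
  case: e e0 zeA => e e'; rewrite ltcE/= => /andP[/eqP -> e0] zeA.
  exists e => // y yz; apply: zeA; rewrite -ball_normE/= normC_cmod cmodB.
  by rewrite ltcE/= eqxx.
apply/nbhs_ballP; exists e%:C; first by rewrite /= ltcR.
by move=> y; rewrite -ball_normE/= normC_cmod ltcR cmodB; exact: zeA.
Qed.

Lemma cvgC T (F : set_system T) {FF : Filter F} (g : T -> C^o) (l : C^o) :
  g @ F --> l <-> forall e, 0 < e -> \forall x \near F, cmod (g x - l) < e.
Proof.
split=> [gl e e0|H A /nbhsC [e e0 eA]].
  by apply: (gl [set y : C^o | cmod (y - l) < e]); apply/nbhsC; exists e.
by apply: filterS (H _ e0) => x; exact: eA.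
Qed.

Lemma openC (A : set C^o) :
  open A <-> forall z, A z -> exists2 e, 0 < e & forall y, cmod (y - z) < e -> A y.
Proof.
by rewrite openE; split=> H z /H /nbhsC.
Qed.

(** Continuity in terms of the real modulus; unlike the topological predicate
    it carries no filter on [R[i]^o] through the proofs. *)
Definition cont_at (f : C -> C) z := forall e, 0 < e -> exists2 d, 0 < d &
    forall y, cmod (y - z) < d -> cmod (f y - f z) < e.

Lemma continuousC (f : C -> C) z :
  {for z, continuous (f : C^o -> C^o)} <-> cont_at f z.
Proof.
have P := @cvgC _ (nbhs (z : C^o)) _ f (f z); split=> [/P H e e0|H].
  by have /nbhsC[d d0 H'] := H e e0; exists d.
by apply/P => e e0; apply/nbhsC; exact: H.
Qed.

Lemma closureC (A : set C^o) z :
  closure A z <-> forall e, 0 < e -> exists2 y, A y & cmod (y - z) < e.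
Proof.
split=> [H e e0|H B /nbhsC[e e0 eB]].
  have [|y [Ay yz]] := H [set y | cmod (y - z) < e]; last by exists y.
  by apply/nbhsC; exists e.
by have [y Ay yz] := H _ e0; exists y; split=> //; apply: eB.
Qed.

Definition cder (f : C -> C) (z l : C) := is_derive (z : C^o) 1 (f : C^o -> C^o) l.

Lemma cderP f z l : cder f z l <-> forall e, 0 < e -> exists2 d, 0 < d &
  forall k, cmod k < d -> cmod (f (z + k) - f z - l * k) <= e * cmod k.
Proof.
split=> [/is_derive1P H e e0|H].
  have [|[d d'] /= d0 {}H] := H e%:C; first by rewrite ltcR.
  move: d0 H; rewrite ltcE/= => /andP[/eqP -> d0] H; exists d => // k kd.
  have := H k; rewrite !normC_cmod ltcR => /(_ kd).
  by rewrite -rmorphM/= lecR.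
apply/is_derive1P => -[e e']; rewrite ltcE/= => /andP[/eqP -> e0].
have [d d0 {}H] := H _ e0; exists d%:C; first by rewrite ltcR.
move=> k; rewrite !normC_cmod ltcR => /H {}H.
have -> : e +i* 0 = e%:C by [].
by rewrite -rmorphM/= lecR.
Qed.

Lemma cder_cst a z : cder (fun=> a) z 0.
Proof. exact: is_derive_cst. Qed.

Lemma cder_id z : cder id z 1.
Proof. exact: is_derive_id. Qed.

Lemma cderD f g z k l : cder f z k -> cder g z l ->
  cder (fun x => f x + g x) z (k + l).
Proof. by move=> fk gl; exact: is_deriveD. Qed.

Lemma cderB f g z k l : cder f z k -> cder g z l ->
  cder (fun x => f x - g x) z (k - l).
Proof. by move=> fk gl; exact: is_deriveB. Qed.

Lemma cderM f g z k l : cder f z k -> cder g z l ->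
  cder (fun x => f x * g x) z (f z * l + g z * k).
Proof. by move=> fk gl; exact: is_deriveM. Qed.

Lemma cderZ a f z k : cder f z k -> cder (fun x => a * f x) z (a * k).
Proof. by move=> fk; exact: is_deriveZ. Qed.

Lemma cderV f z k : f z != 0 -> cder f z k ->
  cder (fun x => (f x)^-1) z (- (f z) ^- 2 * k).
Proof.
move=> fz [df <-]; apply: DeriveDef; first exact: derivableV.
by rewrite deriveV.
Qed.

Lemma cder_comp f g z k l : cder g z l -> cder f (g z) k ->
  cder (fun x => f (g x)) z (k * l).
Proof.
move=> /cderP gl /cderP fk; apply/cderP => e e0.
(* The increment of [g] is at most [M] times that of the variable. *)
set M := cmod l + 1; have M0 : 0 < M by rewrite ltr_wpDl ?cmod_ge0.
have [d1 d10 H1] := gl _ ltr01.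
have eM : 0 < e / 2 / M by rewrite !divr_gt0.
have [d2 d20 H2] := fk _ eM.
have k1 : 0 < cmod k + 1 by rewrite ltr_wpDl ?cmod_ge0.
have ek : 0 < e / 2 / (cmod k + 1) by rewrite !divr_gt0.
have [d3 d30 H3] := gl _ ek.
exists (Num.min d1 (Num.min (d2 / M) d3)).
  by rewrite !lt_min d10 d30 divr_gt0.
move=> h; rewrite !lt_min => /and3P[hd1 hd2 hd3].
set q := g (z + h) - g z.
have qM : cmod q <= M * cmod h.
  have := H1 _ hd1; have := cmodD (q - l * h) (l * h).
  by rewrite subrK cmodM mul1r /M mulrDl mul1r; lra.
have qd2 : cmod q < d2.
  by apply: le_lt_trans qM _; rewrite mulrC -ltr_pdivlMr.
have -> : f (g (z + h)) - f (g z) - k * l * h =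
   (f (g z + q) - f (g z) - k * q) + k * (q - l * h).
  by rewrite /q [g z + _]addrC subrK; move: (f _) (f _) => ? ?; ring.
apply: (le_trans (cmodD _ _)); rewrite cmodM.
have A : cmod (f (g z + q) - f (g z) - k * q) <= e / 2 * cmod h.
  apply: le_trans (H2 _ qd2) _.
  apply: le_trans (ler_wpM2l (ltW eM) qM) _.
  by rewrite mulrA divfK ?gt_eqF.
have B : cmod k * cmod (q - l * h) <= e / 2 * cmod h.
  apply: le_trans (ler_wpM2l (cmod_ge0 _) (H3 _ hd3)) _.
  rewrite mulrA ler_wpM2r ?cmod_ge0// mulrA ler_pdivrMr//.
  by rewrite mulrC ler_wpM2l ?divr_ge0 ?ltW// ltrDl.
by apply: le_trans (lerD A B) _; rewrite -mulrDl; lra.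
Qed.

Lemma cder_cont_at f z l : cder f z l -> cont_at f z.
Proof.
move=> /cderP H e e0.
set M := cmod l + 1; have M0 : 0 < M by rewrite ltr_wpDl ?cmod_ge0.
have [d d0 {}H] := H _ ltr01.
exists (Num.min d (e / M)); first by rewrite lt_min d0 divr_gt0.
move=> y; rewrite lt_min => /andP[/H]; rewrite [z + _]addrC subrK => {}H yz.
have := cmodD (f y - f z - l * (y - z)) (l * (y - z)).
move: yz; rewrite subrK cmodM ltr_pdivlMr// mulrC /M mulrDl => yz.
by lra.
Qed.

Lemma cder_near f g z l r : 0 < r ->
  (forall y, cmod (y - z) < r -> f y = g y) -> cder f z l -> cder g z l.
Proof.
move=> r0 fg /cderP H; apply/cderP => e /H[d d0 {}H].
exists (Num.min d r) => [|k]; first by rewrite lt_min d0.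
rewrite lt_min => /andP[kd kr]; rewrite -!fg ?subrr ?cmod0//; first exact: H.
by rewrite addrC addKr.
Qed.
End Modulus.

(** * The mean value inequality *)

Section MeanValue.
Context {R : realType}.
Local Notation C := R[i].
Implicit Types (x y z w k l : C) (e d r : R).

(** A wrapper and not an abbreviation: derivability unfolds to the convergence
    of a filter, which unification would explore at each use. *)
Variant holo (f : C -> C) z : Prop :=
  Holo of derivable (f : C^o -> C^o) z 1.

Definition der (f : C -> C) z : C := 'D_(1 : C^o) (f : C^o -> C^o) z.

Lemma cder_holo f z l : cder f z l -> holo f z.
Proof. by case=> fz _; exact: Holo. Qed.

Lemma holo_cder f z : holo f z -> cder f z (der f z).
Proof. by case=> fz; exact: derivableP. Qed.

Lemma cder_der f z l : cder f z l -> der f z = l.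
Proof. by case. Qed.

Lemma holo_cont_at f z : holo f z -> cont_at f z.
Proof. by move/holo_cder/cder_cont_at. Qed.

(** Projecting onto a direction [c] reduces a complex function along a segment
    to a real function, to which the real mean value theorem applies. *)
Lemma is_derive_Re_line (c : C) f z v (t : R) l :
  cder f (z + t%:C * v) l ->
  is_derive (t : R^o) 1
    ((fun s => complex.Re (c * f (z + s%:C * v))) : R^o -> R^o)
    (complex.Re (c * l * v)).
Proof.
move=> /cderP H; apply/is_derive1P => e e0.
set M := cmod c * cmod v + 1.
have M0 : 0 < M by rewrite ltr_wpDl// mulr_ge0 ?cmod_ge0.
have [d d0 {}H] := H _ (divr_gt0 e0 M0).
have v1 : 0 < cmod v + 1 by rewrite ltr_wpDl ?cmod_ge0.
exists (d / (cmod v + 1)); first exact: divr_gt0.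
move=> h; rewrite ltr_pdivlMr// => hd.
have -> : complex.Re (c * f (z + (t + h)%:C * v)) - complex.Re (c * f (z + t%:C * v))
     - complex.Re (c * l * v) * h = complex.Re (c * (f (z + t%:C * v + h%:C * v)
       - f (z + t%:C * v) - l * (h%:C * v))).
  rewrite rmorphD mulrDl addrA.
  move: (f _) (f _) => [a b] [a' b']; case: c l v {H M M0 hd v1} => [? ?] [? ?] [? ?] /=.
  ring.
apply: (le_trans (Re_le_cmod _)); rewrite cmodM.
have hv : cmod (h%:C * v) < d.
  rewrite cmodM cmod_real; apply: le_lt_trans hd.
  by rewrite ler_wpM2l// lerDl.
apply: (le_trans (ler_wpM2l (cmod_ge0 _) (H _ hv))).
rewrite cmodM cmod_real.
have -> : cmod c * (e / M * (`|h| * cmod v)) = e * `|h| * ((cmod c * cmod v) / M).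
  by field; rewrite gt_eqF.
rewrite ler_piMr//; first by rewrite mulr_ge0// ltW.
by rewrite ler_pdivrMr// mul1r lerDl.
Qed.

Lemma ReB z w : complex.Re (z - w) = complex.Re z - complex.Re w.
Proof. by case: z w => [? ?] [? ?]. Qed.

Lemma cmod_sqr_conj z : complex.Re (z^* * z) = cmod z ^+ 2.
Proof.
rewrite cmodE sqr_sqrtr; last by rewrite addr_ge0 ?sqr_ge0.
by case: z => a b /=; ring.
Qed.

Lemma cmod_conj z : cmod z^* = cmod z.
Proof. by case: z => a b; rewrite !cmodE /= sqrrN. Qed.

(** The mean value theorem is applied to the component of [f] along its own
    increment [u]: the derivative of that component is at most
    [cmod u * M * cmod v], and its total variation is [cmod u ^+ 2]. *)
Lemma mean_value_le f z v M :
  (forall t, 0 <= t <= 1 -> holo f (z + t%:C * v) /\ cmod (der f (z + t%:C * v)) <= M) ->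
  cmod (f (z + v) - f z) <= M * cmod v.
Proof.
move=> H.
set u := f (z + v) - f z.
pose phi := (fun s : R => complex.Re (u^* * f (z + s%:C * v))) : R^o -> R^o.
pose dphi (t : R) : R^o := complex.Re (u^* * der f (z + t%:C * v) * v).
have D t : 0 <= t <= 1 -> is_derive (t : R^o) 1 phi (dphi t).
  by move=> /H[/holo_cder hf _]; exact: is_derive_Re_line.
have [x|x|c c01] := @MVT_segment R phi dphi 0 1 ler01.
- by rewrite in_itv/= => /andP[? ?]; apply: D; rewrite !ltW.
- move: x; apply: derivable_within_continuous => x; rewrite in_itv/= => /D.
  by case.
rewrite /phi /dphi rmorph0 rmorph1 subr0 mulr1 mul1r mul0r addr0 => E.
have {}E : cmod u ^+ 2 = complex.Re (u^* * der f (z + c%:C * v) * v).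
  rewrite -E -cmod_sqr_conj -ReB -mulrBr//.
have [u0|u0] := eqVneq (cmod u) 0.
  have [_ M0] := H 0 (introT andP (conj (lexx 0) ler01)).
  by rewrite u0 mulr_ge0 ?cmod_ge0// (le_trans _ M0) ?cmod_ge0.
have up : 0 < cmod u by rewrite lt_def u0 cmod_ge0.
rewrite -(ler_pM2l up) -expr2 E.
apply: (le_trans (ler_norm _)); apply: (le_trans (Re_le_cmod _)).
rewrite !cmodM cmod_conj -mulrA ler_wpM2l ?cmod_ge0// ler_wpM2r ?cmod_ge0//.
by have [] := H c; rewrite // -in_itv.
Qed.

Lemma mean_value_ball f z r M :
  (forall y, cmod (y - z) < r -> holo f y /\ cmod (der f y) <= M) ->
  forall x y, cmod (x - z) < r -> cmod (y - z) < r ->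
    cmod (f y - f x) <= M * cmod (y - x).
Proof.
move=> H x y xr yr; have := @mean_value_le f x (y - x) M.
rewrite [x + (y - x)]addrC subrK; apply=> t /andP[t0 t1]; apply: H.
have -> : x + t%:C * (y - x) - z = (1 - t)%:C * (x - z) + t%:C * (y - z).
  by rewrite rmorphB/= rmorph1; ring.
apply: (le_lt_trans (cmodD _ _)); rewrite !cmodM !cmod_real !ger0_norm ?subr_ge0//.
have := cmod_ge0 (x - z); have := cmod_ge0 (y - z).
have [->|tn] := eqVneq t 0; first by rewrite mul0r subr0; lra.
have tp : 0 < t by rewrite lt_def tn.
nra.
Qed.
End MeanValue.

(** * The complex exponential *)

Section ComplexExponential.
Context {R : realType}.
Local Notation C := R[i].
Implicit Types (x y z w k l : C) (e d r : R).

Definition cexp z : C :=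
  (expR (complex.Re z) * cos (complex.Im z)) +i*
  (expR (complex.Re z) * sin (complex.Im z)).

Lemma cexpD z w : cexp (z + w) = cexp z * cexp w.
Proof.
case: z w => a b [a' b']; rewrite /cexp /= expRD cosD sinD.
by apply/eqP; rewrite eq_complex /=; apply/andP; split; apply/eqP; ring.
Qed.

Lemma cexp0 : cexp 0 = 1.
Proof. by rewrite /cexp /= expR0 cos0 sin0 !mul1r. Qed.

Lemma cmod_cexp z : cmod (cexp z) = expR (complex.Re z).
Proof.
rewrite cmodE /= !exprMn -mulrDr cos2Dsin2 mulr1 sqrtr_sqr ger0_norm//.
Qed.

Lemma cexp_neq0 z : cexp z != 0.
Proof. by rewrite -cmod_eq0 cmod_cexp gt_eqF// expR_gt0. Qed.

Lemma cder_cexp0 : cder cexp 0 1.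
Proof.
apply/cderP => e e0.
have He := is_derive_expR (0 : R); have Hc := is_derive_cos (0 : R).
have Hs := is_derive_sin (0 : R).
have e4 : 0 < e / 4 by rewrite divr_gt0.
have e8 : 0 < e / 8 by rewrite divr_gt0.
have [d1 d10 H1] := (is_derive1P _ _ _).1 He _ e4.
have [d2 d20 H2] := (is_derive1P _ _ _).1 Hc _ e8.
have [d3 d30 H3] := (is_derive1P _ _ _).1 Hs _ e8.
have [d4 d40 H4] := (is_derive1P _ _ _).1 He _ ltr01.
exists (Num.min d1 (Num.min d2 (Num.min d3 (Num.min d4 (Num.min 2^-1 (e / 8)))))).
  by rewrite !lt_min d10 d20 d30 d40 invr_gt0 e8 ltr0n.
case=> a b; rewrite !lt_min => /and5P[kd1 kd2 kd3 kd4 /andP[kd5 kd6]].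
have ka := Re_le_cmod (a +i* b); have kb := Im_le_cmod (a +i* b).
rewrite cexp0 mul1r add0r; apply: (le_trans (cmod_le_ReIm _)).
move: (cmod (a +i* b)) ka kb kd1 kd2 kd3 kd4 kd5 kd6 => n /= ka kb kd1 kd2 kd3 kd4 kd5 kd6.
have {H1} := H1 a (le_lt_trans ka kd1); have {H2} := H2 b (le_lt_trans kb kd2).
have {H3} := H3 b (le_lt_trans kb kd3); have {H4} := H4 a (le_lt_trans ka kd4).
rewrite !add0r expR0 cos0 sin0 oppr0 !mul0r !mul1r !subr0 !addr0.
move: (expR a) (cos b) (sin b) => E c s H4 H3 H2 H1.
have an := normr_ge0 a; have bn := normr_ge0 b.
have E1 : `|E - 1| <= 2 * `|a|.
  have := ler_normD (E - 1 - a) a; rewrite subrK; lra.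
have E2 : `|E| <= 2.
  have := ler_normD (E - 1) 1; rewrite subrK normr1; lra.
have -> : E * c - 1 - a = (E - 1 - a) + E * (c - 1) by ring.
have -> : E * s - b = E * (s - b) + (E - 1) * b by ring.
have T1 := ler_normD (E - 1 - a) (E * (c - 1)).
have T2 := ler_normD (E * (s - b)) ((E - 1) * b).
move: T1 T2; rewrite !normrM => T1 T2.
have X1 : `|E| * `|c - 1| <= 2 * (e / 8 * `|b|) by apply: ler_pM.
have X2 : `|E| * `|s - b| <= 2 * (e / 8 * `|b|) by apply: ler_pM.
have X3 : `|E - 1| * `|b| <= 2 * `|a| * `|b| by rewrite ler_wpM2r.
have X4 : 2 * `|a| * `|b| <= 2 * (e / 8) * n.
  by rewrite -!mulrA ler_wpM2l// [X in _ <= X]mulrA ler_pM//; lra.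
have X5 : e / 8 * `|b| <= e / 8 * n by rewrite ler_wpM2l// ltW.
have X6 : e / 4 * `|a| <= e / 4 * n by rewrite ler_wpM2l// ltW.
apply: le_trans (lerD T1 T2) _.
by nra.
Qed.

Lemma cder_cexp z : cder cexp z (cexp z).
Proof.
apply/cderP => e e0.
have n0 : 0 < cmod (cexp z) by rewrite cmod_gt0 cexp_neq0.
have [d d0 H] := (cderP _ _ _).1 cder_cexp0 _ (divr_gt0 e0 n0).
exists d => // k /H; rewrite cexp0 add0r mul1r => {}H.
have -> : cexp (z + k) - cexp z - cexp z * k = cexp z * (cexp k - 1 - k).
  by rewrite cexpD; ring.
rewrite cmodM; apply: le_trans (ler_wpM2l (cmod_ge0 _) H) _.
by rewrite mulrA mulrCA divff ?gt_eqF// mulr1.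
Qed.

Lemma cexp_polar w : w != 0 ->
  exists2 z, cexp z = w & `|complex.Im z| <= pi.
Proof.
case: w => u v w0; set n := cmod (u +i* v).
have n0 : 0 < n by rewrite cmod_gt0.
have nE : n ^+ 2 = u ^+ 2 + v ^+ 2.
  by rewrite /n cmodE sqr_sqrtr ?addr_ge0 ?sqr_ge0.
have u1 : -1 <= u / n <= 1.
  rewrite -ler_norml normrM normfV (gtr0_norm n0) ler_pdivrMr// mul1r.
  exact: (Re_le_cmod (u +i* v)).
have sE : sin (acos (u / n)) = `|v| / n.
  rewrite sin_acos// -[RHS]ger0_norm ?divr_ge0 ?(ltW n0)// -sqrtr_sqr; congr Num.sqrt.
  rewrite !expr_div_n real_normK ?num_real// nE.
  by field; rewrite -nE expf_neq0// gt_eqF.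
pose t := if 0 <= v then acos (u / n) else - acos (u / n).
exists (ln n +i* t).
  rewrite /cexp /= lnK// /t.
  have -> : cos (if 0 <= v then acos (u / n) else - acos (u / n)) = u / n.
    by case: ifP => _; rewrite ?cosN acosK// in_itv.
  have -> : sin (if 0 <= v then acos (u / n) else - acos (u / n)) = v / n.
    case: ifPn => v0; first by rewrite sE ger0_norm.
    by rewrite sinN sE -mulNr ltr0_norm ?opprK// ltNge.
  by rewrite !(mulrC n) !divfK// gt_eqF.
rewrite /= /t; have := acos_ge0 u1; have := acos_lepi u1.
by case: ifP => _ ? ?; rewrite ?normrN ger0_norm.
Qed.
End ComplexExponential.

(** * Goursat's theorem for closed differential forms *)

Section Goursat.
Context {R : realType}.
Implicit Types (a b c u v p q x y e d M : R) (g : R -> R).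

Definition itg a b g : R := \int[lebesgue_measure]_(x in `[a, b]) g x.

Definition cont_on a b g := {in `[a, b], continuous (g : R^o -> R^o)}.

Lemma cont_on_sub a b c d g : a <= c -> d <= b -> cont_on a b g -> cont_on c d g.
Proof.
move=> ac db H x; rewrite in_itv/= => /andP[cx xd]; apply: H.
by rewrite in_itv/= (le_trans ac)//= (le_trans xd).
Qed.

Lemma cont_on_integrable a b g : cont_on a b g ->
  lebesgue_measure.-integrable `[a, b] (EFin \o g).
Proof.
move=> H; apply: continuous_compact_integrable; first exact: segment_compact.
by apply: continuous_in_subspaceT => x /[!inE] xab; exact: H.
Qed.

Lemma itg_split a c b g : a <= c -> c <= b -> cont_on a b g ->
  itg a b g = itg a c g + itg c b g.
Proof.
move=> ac cb H; apply/eqP; rewrite addrC -subr_eq; apply/eqP.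
rewrite /itg (Rintegral_itvB (x := c)) ?bnd_simp//; last exact: cont_on_integrable.
rewrite Rintegral_itv_obnd_cbnd//.
apply: integrableS (cont_on_integrable (cont_on_sub ac (lexx b) H)) => //.
exact: subset_itv_oc_cc.
Qed.

Lemma itgD a b g1 g2 : cont_on a b g1 -> cont_on a b g2 ->
  itg a b (fun x => g1 x + g2 x) = itg a b g1 + itg a b g2.
Proof. by move=> c1 c2; rewrite /itg RintegralD//; exact: cont_on_integrable. Qed.

Lemma itg_cst a b c : a <= b -> itg a b (fun=> c) = c * (b - a).
Proof.
move=> ab; rewrite /itg Rintegral_cst//= lebesgue_measure_itv/= lte_fin.
rewrite le_eqVlt in ab; case/predU1P: ab => [->|ab]; last by rewrite ab.
by rewrite ltxx subrr.
Qed.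

Lemma itg_near a b c M g : a <= b -> cont_on a b g ->
  (forall x, a <= x <= b -> `|g x - c| <= M) ->
  `|itg a b g - c * (b - a)| <= M * (b - a).
Proof.
move=> ab gc H.
have cc (k : R) : lebesgue_measure.-integrable `[a, b] (EFin \o (fun=> k)).
  by apply: cont_on_integrable => x _; exact: cst_continuous.
have U : itg a b g <= itg a b (fun=> c + M).
  apply: le_Rintegral => //; first exact: cont_on_integrable.
  move=> x /=; rewrite in_itv/= => /H; rewrite ler_norml; lra.
have L : itg a b (fun=> c - M) <= itg a b g.
  apply: le_Rintegral => //; first exact: cont_on_integrable.
  move=> x /=; rewrite in_itv/= => /H; rewrite ler_norml; lra.
move: U L; rewrite !itg_cst// => U L.
by rewrite ler_norml; lra.
Qed.

Lemma itg_ext a b g1 g2 : (forall x, a <= x <= b -> g1 x = g2 x) ->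
  itg a b g1 = itg a b g2.
Proof. by move=> H; apply: eq_Rintegral => x; rewrite inE/= in_itv/= => /H. Qed.

(** The limit is the supremum of the left end points; the right end points
    decrease. *)
Lemma nested_halving (s : nat -> R) a : 0 <= a ->
  (forall n, exists i : bool, s n.+1 = s n + i%:R * (a / 2 ^+ n.+1)) ->
  exists p, forall n, s n <= p <= s n + a / 2 ^+ n.
Proof.
move=> a0 H.
have half n : a / 2 ^+ n.+1 = a / 2 ^+ n / 2 by rewrite exprS; field.
have an n : 0 <= a / 2 ^+ n by rewrite divr_ge0.
have S n k : s n <= s (n + k)%N /\ s (n + k)%N + a / 2 ^+ (n + k) <= s n + a / 2 ^+ n.
  elim: k => [|k [IH1 IH2]]; first by rewrite addn0.
  have := an (n + k)%N.
  rewrite addnS; case: (H (n + k)%N) => -[] ->; rewrite half /=; lra.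
have B m n : s m <= s n + a / 2 ^+ n.
  have [mn|/ltnW cmod] := leqP m n.
    have [+ _] := S m (n - m)%N; rewrite subnKC//; have := an n; lra.
  have [_] := S n (m - n)%N; rewrite subnKC//; have := an m; lra.
have ne : range s !=set0 by exists (s 0%N); exists 0%N.
exists (sup (range s)) => n; apply/andP; split.
  apply: ub_le_sup; last by exists n.
  by exists (s 0%N + a / 2 ^+ 0) => _ [m _ <-].
by apply: ge_sup => // _ [m _ <-].
Qed.

(** The two booleans choose one of the four quarters of a rectangle, so a
    property inherited by some quarter concentrates at a point. *)
Lemma bisection a b (Phi : nat -> R -> R -> Prop) u0 v0 : 0 <= a -> 0 <= b ->
  Phi 0%N u0 v0 ->
  (forall n u v, Phi n u v -> exists i j : bool,
     Phi n.+1 (u + i%:R * (a / 2 ^+ n.+1)) (v + j%:R * (b / 2 ^+ n.+1))) ->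
  exists p q, forall n, exists u v,
    [/\ Phi n u v, u <= p <= u + a / 2 ^+ n & v <= q <= v + b / 2 ^+ n].
Proof.
move=> a0 b0 P0 PS.
have /choice[F HF] : forall t : nat * R * R, exists ij : bool * bool,
    Phi t.1.1 t.1.2 t.2 -> Phi t.1.1.+1 (t.1.2 + ij.1%:R * (a / 2 ^+ t.1.1.+1))
      (t.2 + ij.2%:R * (b / 2 ^+ t.1.1.+1)).
  move=> [[n u] v] /=; have [/PS[i [j H]]|H] := pselect (Phi n u v).
    by exists (i, j).
  by exists (true, true).
pose s := fix s n : R * R := if n is m.+1 then
  let uv := s m in let ij := F (m, uv.1, uv.2) in
  (uv.1 + ij.1%:R * (a / 2 ^+ m.+1), uv.2 + ij.2%:R * (b / 2 ^+ m.+1))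
  else (u0, v0).
have HP n : Phi n (s n).1 (s n).2.
  by elim: n => [//|n IH] /=; exact: (HF (n, (s n).1, (s n).2)).
have [|p Hp] := @nested_halving (fun n => (s n).1) a a0.
  by move=> n; exists (F (n, (s n).1, (s n).2)).1.
have [|q Hq] := @nested_halving (fun n => (s n).2) b b0.
  by move=> n; exists (F (n, (s n).1, (s n).2)).2.
by exists p, q => n; exists (s n).1, (s n).2.
Qed.

(** The form is [P dx + Q dy]; the shared coefficient [p2] expresses that the
    derivatives [dP/dy] and [dQ/dx] agree at [(p, q)]. *)
Definition closed_form_at (P Q : R -> R -> R) p q :=
  exists p1 p2 q2, forall e, 0 < e -> exists2 d, 0 < d &
    forall x y, `|x - p| < d -> `|y - q| < d ->
      `|P x y - P p q - p1 * (x - p) - p2 * (y - q)| <= e * (`|x - p| + `|y - q|) /\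
      `|Q x y - Q p q - p2 * (x - p) - q2 * (y - q)| <= e * (`|x - p| + `|y - q|).

Lemma cont_of_affine g l x :
  (forall e, 0 < e -> exists2 d, 0 < d & forall y, `|y - x| < d ->
    `|g y - g x - l * (y - x)| <= e * `|y - x|) ->
  {for x, continuous (g : R^o -> R^o)}.
Proof.
move=> H; apply/cvgrPdist_lt => e e0.
have [d d0 {}H] := H _ ltr01.
set M := `|l| + 1; have M0 : 0 < M by rewrite ltr_wpDl.
have m0 : 0 < Num.min d (e / M) by rewrite lt_min d0 divr_gt0.
exists (Num.min d (e / M)) => // y /=; rewrite distrC lt_min ltr_pdivlMr// => /andP[/H A yd].
rewrite distrC; have := ler_normD (g y - g x - l * (y - x)) (l * (y - x)).
by move: yd; rewrite subrK normrM /M; lra.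
Qed.

Lemma closed_form_cont P Q p q : closed_form_at P Q p q ->
  {for p, continuous ((fun x => P x q) : R^o -> R^o)} /\
  {for q, continuous ((fun y => Q p y) : R^o -> R^o)}.
Proof.
move=> [p1 [p2 [q2 H]]]; split.
- apply: (@cont_of_affine _ p1) => e /H[d d0 {}H]; exists d => // x xp.
  have [|+ _] := H x q xp; first by rewrite subrr normr0.
  by rewrite subrr normr0 mulr0 subr0 addr0.
- apply: (@cont_of_affine _ q2) => e /H[d d0 {}H]; exists d => // y yq.
  have [|_ +] := H p y _ yq; first by rewrite subrr normr0.
  by rewrite subrr normr0 mulr0 subr0 add0r.
Qed.

(** Opposite sides are paired under one integral: near a point each integrand
    is then a constant up to an error of higher order. *)
Definition circulation (P Q : R -> R -> R) u v a b : R :=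
  itg v (v + b) (fun y => Q (u + a) y - Q u y) -
  itg u (u + a) (fun x => P x (v + b) - P x v).

Definition closed_form_on P Q u v a b := forall p q,
  u <= p <= u + a -> v <= q <= v + b -> closed_form_at P Q p q.

Lemma closed_form_contQ P Q u v a b x y : closed_form_on P Q u v a b ->
  u <= x <= u + a -> u <= y <= u + a ->
  cont_on v (v + b) (fun t => Q x t - Q y t).
Proof.
move=> H xu yu t; rewrite in_itv/= => tv.
apply: continuousB; first exact: (closed_form_cont (H _ _ xu tv)).2.
exact: (closed_form_cont (H _ _ yu tv)).2.
Qed.

Lemma closed_form_contP P Q u v a b x y : closed_form_on P Q u v a b ->
  v <= x <= v + b -> v <= y <= v + b ->
  cont_on u (u + a) (fun t => P t x - P t y).
Proof.
move=> H xu yu t; rewrite in_itv/= => tv.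
apply: continuousB; first exact: (closed_form_cont (H _ _ tv xu)).1.
exact: (closed_form_cont (H _ _ tv yu)).1.
Qed.

Lemma circulation_split P Q u v a b : 0 <= a -> 0 <= b ->
  closed_form_on P Q u v (a + a) (b + b) ->
  circulation P Q u v (a + a) (b + b) =
    (circulation P Q u v a b + circulation P Q (u + a) v a b) +
    (circulation P Q u (v + b) a b + circulation P Q (u + a) (v + b) a b).
Proof.
move=> a0 b0 H; rewrite /circulation !addrA.
have Hu : [/\ u <= u <= u + (a + a), u <= u + a <= u + (a + a) &
   u <= u + a + a <= u + (a + a)] by split; lra.
have Hv : [/\ v <= v <= v + (b + b), v <= v + b <= v + (b + b) &
   v <= v + b + b <= v + (b + b)] by split; lra.
case: Hu Hv => U0 U1 U2 [V0 V1 V2].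
have S1 s s' : u <= s <= u + (a + a) -> u <= s' <= u + (a + a) ->
   itg v (v + b + b) (fun y => Q s y - Q s' y) =
   itg v (v + b) (fun y => Q s y - Q s' y) +
   itg (v + b) (v + b + b) (fun y => Q s y - Q s' y).
  move=> Hs Hs'; apply: itg_split; [lra|lra|].
  by rewrite -addrA; exact: (closed_form_contQ H).
have S2 s s' : v <= s <= v + (b + b) -> v <= s' <= v + (b + b) ->
   itg u (u + a + a) (fun y => P y s - P y s') =
   itg u (u + a) (fun y => P y s - P y s') +
   itg (u + a) (u + a + a) (fun y => P y s - P y s').
  move=> Hs Hs'; apply: itg_split; [lra|lra|].
  by rewrite -addrA; exact: (closed_form_contP H).
have A1 : itg v (v + b + b) (fun y => Q (u + a + a) y - Q u y) =
  itg v (v + b + b) (fun y => Q (u + a + a) y - Q (u + a) y) +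
  itg v (v + b + b) (fun y => Q (u + a) y - Q u y).
  rewrite -itgD; first by apply: itg_ext => x _; rewrite subrKA.
  - by rewrite -(addrA v); exact: (closed_form_contQ H).
  - by rewrite -(addrA v); exact: (closed_form_contQ H).
have A2 : itg u (u + a + a) (fun y => P y (v + b + b) - P y v) =
  itg u (u + a + a) (fun y => P y (v + b + b) - P y (v + b)) +
  itg u (u + a + a) (fun y => P y (v + b) - P y v).
  rewrite -itgD; first by apply: itg_ext => x _; rewrite subrKA.
  - by rewrite -(addrA u); exact: (closed_form_contP H).
  - by rewrite -(addrA u); exact: (closed_form_contP H).
rewrite A1 A2 !S1 ?S2//.
ring.
Qed.

(** Goursat's bisection. The expansion of the form is only pointwise, hence the
    descent to one point instead of Green's formula. *)
Theorem goursat P Q u v a b : 0 <= a -> 0 <= b ->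
  closed_form_on P Q u v a b -> circulation P Q u v a b = 0.
Proof.
move=> a0 b0 H; apply/eqP; apply: contraT => W0.
pose w : R := `|circulation P Q u v a b|; have w0 : 0 < w by rewrite normr_gt0.
have an n : 0 <= a / 2 ^+ n by rewrite divr_ge0.
have bn n : 0 <= b / 2 ^+ n by rewrite divr_ge0.
pose Phi n s t := [/\ u <= s, s + a / 2 ^+ n <= u + a,
  v <= t, t + b / 2 ^+ n <= v + b &
  w / 4 ^+ n <= `|circulation P Q s t (a / 2 ^+ n) (b / 2 ^+ n)|].
(* One of the four quarters keeps at least a quarter of the circulation. *)
have [||p [q Hpq]] := @bisection a b Phi u v a0 b0.
- by split; rewrite ?expr0 ?divr1.
- move=> n s t [us sa vt tb W].
  have ha : a / 2 ^+ n = a / 2 ^+ n.+1 + a / 2 ^+ n.+1 by rewrite exprS; field.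
  have hb : b / 2 ^+ n = b / 2 ^+ n.+1 + b / 2 ^+ n.+1 by rewrite exprS; field.
  have hw : w / 4 ^+ n = 4 * (w / 4 ^+ n.+1) by rewrite exprS; field.
  have sub : closed_form_on P Q s t (a / 2 ^+ n) (b / 2 ^+ n).
    by move=> x y Hx Hy; apply: H; lra.
  move: W sa tb sub; rewrite ha hb hw => W sa tb sub.
  move: W sa tb; rewrite (circulation_split _ _ sub)//.
  rewrite /Phi; have := an n.+1; have := bn n.+1.
  move: (a / 2 ^+ n.+1) (b / 2 ^+ n.+1) (w / 4 ^+ n.+1) => a' b' w' b'0 a'0 W sa tb.
  have [c1|c1] := leP w' `|circulation P Q s t a' b'|.
    by exists false, false; rewrite !mul0r !addr0; split=> //; lra.
  have [c2|c2] := leP w' `|circulation P Q (s + a') t a' b'|.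
    by exists true, false; rewrite mul0r mul1r addr0; split=> //; lra.
  have [c3|c3] := leP w' `|circulation P Q s (t + b') a' b'|.
    by exists false, true; rewrite mul0r mul1r addr0; split=> //; lra.
  exists true, true; rewrite !mul1r; split=> //; [lra..|].
  move: W c1 c2 c3.
  move: (circulation _ _ _ _ _ _) (circulation _ _ _ _ _ _)
    (circulation _ _ _ _ _ _) (circulation _ _ _ _ _ _) => A B C D W c1 c2 c3.
  have := ler_normD (D + C) (B + A); have := ler_normD D C; have := ler_normD B A.
  lra.
(* The rectangles shrink to [(p, q)], where both forms are affine up to
   [e * (a' + b')]. Opposite sides then contribute [p2 * a' * b'] each and
   cancel, so a circulation of at least [w / 4 ^+ n] is too large. *)
have pu : u <= p <= u + a.
  by have [s [t [[]]]] := Hpq 0%N; rewrite expr0 !divr1; lra.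
have qv : v <= q <= v + b.
  by have [s [t [[]]]] := Hpq 0%N; rewrite expr0 !divr1; lra.
have [p1 [p2 [q2 Hd]]] := H _ _ pu qv.
(* [e] is chosen so that [2 * e * (a + b) ^+ 2 < w]. *)
set c := a + b; have c0 : 0 <= c by rewrite addr_ge0.
have c1 : 0 < 2 * c ^+ 2 + 1 by rewrite ltr_wpDl// mulr_ge0// sqr_ge0.
set e := w / 2 / (2 * c ^+ 2 + 1); have e0 : 0 < e by rewrite !divr_gt0.
have [d d0 {}Hd] := Hd _ e0.
have [n nd] : exists n, c / 2 ^+ n < d.
  have cd : 0 <= c / d by rewrite divr_ge0// ltW.
  exists (Num.truncn (c / d)).+1.
  rewrite ltr_pdivrMr ?exprn_gt0// mulrC -ltr_pdivrMr//.
  apply: (lt_le_trans (truncnS_gt _)).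
  by rewrite -natrX ler_nat ltnW// ltn_expl.
have [s [t [[us sa vt tb W] sp tq]]] := Hpq n.
move: W sp tq sa tb nd.
have -> : c / 2 ^+ n = a / 2 ^+ n + b / 2 ^+ n by rewrite mulrDl.
have := an n; have := bn n.
have Ec : c ^+ 2 / 4 ^+ n = (a / 2 ^+ n + b / 2 ^+ n) ^+ 2.
  rewrite -mulrDl -/c expr_div_n -exprM mulnC exprM; congr (_ / _ ^+ _).
  by rewrite expr2; lra.
have En : 0 < (4 : R) ^+ n by rewrite exprn_gt0.
move: (a / 2 ^+ n) (b / 2 ^+ n) Ec => a' b' Ec b'0 a'0 W sp tq sa tb nd.
have near x y : s <= x <= s + a' -> t <= y <= t + b' ->
   `|P x y - P p q - p1 * (x - p) - p2 * (y - q)| <= e * (a' + b') /\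
   `|Q x y - Q p q - p2 * (x - p) - q2 * (y - q)| <= e * (a' + b').
  move=> Hx Hy.
  have xp : `|x - p| <= a' by rewrite ler_norml; lra.
  have yq : `|y - q| <= b' by rewrite ler_norml; lra.
  have [||A B] := Hd x y; [lra|lra|].
  have : e * (`|x - p| + `|y - q|) <= e * (a' + b')
    by apply: ler_wpM2l; [exact: ltW|exact: lerD].
  by move=> E; split; [apply: le_trans A E|apply: le_trans B E].
have sub : closed_form_on P Q s t a' b' by move=> x y Hx Hy; apply: H; lra.
set e' := e * (a' + b') in near.
have I1 : `|itg t (t + b') (fun y => Q (s + a') y - Q s y) - p2 * a' * (t + b' - t)|
    <= 2 * e' * (t + b' - t).
  apply: itg_near; [lra|by apply: (closed_form_contQ sub); lra|].
  move=> y Hy; have [||_ A] := near (s + a') y => //; first lra.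
  have [||_ B] := near s y => //; first lra.
  by move: A B; rewrite !ler_norml; lra.
have I2 : `|itg s (s + a') (fun x => P x (t + b') - P x t) - p2 * b' * (s + a' - s)|
    <= 2 * e' * (s + a' - s).
  apply: itg_near; [lra|by apply: (closed_form_contP sub); lra|].
  move=> x Hx; have [||A _] := near x (t + b') => //; first lra.
  have [||B _] := near x t => //; first lra.
  by move: A B; rewrite !ler_norml; lra.
have {W} : w / 4 ^+ n <= 2 * e' * (a' + b').
  apply: (le_trans W); rewrite /circulation.
  move: I1 I2; rewrite ![t + b' - t]addrC ![s + a' - s]addrC !addKr.
  move: (itg _ _ _) (itg _ _ _) => A B; rewrite !ler_norml; nra.
have -> : 2 * e' * (a' + b') = 2 * e * (a' + b') ^+ 2 by rewrite /e'; ring.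
rewrite -Ec mulrA ler_pM2r ?invr_gt0// => W.
exfalso; move: W; apply/negP; rewrite -ltNge /e.
rewrite -mulrA [w / 2 / _ * _]mulrAC mulrA ltr_pdivrMr//.
have : 0 <= c ^+ 2 by rewrite sqr_ge0.
by move: w0 => + +; nra.
Qed.
End Goursat.

(** * Circle averages and Cauchy's estimate *)

Section CauchyEstimate.
Context {R : realType}.
Local Notation C := R[i].
Implicit Types (z w k l : C) (e d r : R) (f g q : C -> C).

(** The Cauchy-Riemann equations say that [Im F dx + Re F dy], the imaginary
    part of [F dz], is closed. *)
Lemma cder_closed_form (F : C -> C) (p t : R) l : cder F (p +i* t) l ->
  closed_form_at (fun x y => complex.Im (F (x +i* y)))
                 (fun x y => complex.Re (F (x +i* y))) p t.
Proof.
move=> /cderP H; exists (complex.Im l), (complex.Re l), (- complex.Im l) => e e0.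
have [d d0 {}H] := H _ e0.
exists (d / 2) => [|x y xp yt]; first by rewrite divr_gt0.
have kE : (p +i* t) + ((x - p) +i* (y - t)) = x +i* y.
  by apply/eqP; rewrite eq_complex /= ![_ + (_ - _)]addrC !subrK !eqxx.
have kn := cmod_le_ReIm ((x - p) +i* (y - t)).
have : cmod ((x - p) +i* (y - t)) < d by apply: (le_lt_trans kn) => /=; lra.
move=> /H; rewrite kE; set u := F (x +i* y) - _ - _ => Hu.
have {}Hu : cmod u <= e * (`|x - p| + `|y - t|).
  by apply: le_trans Hu _; rewrite ler_wpM2l// ltW.
have -> : complex.Im (F (x +i* y)) - complex.Im (F (p +i* t))
  - complex.Im l * (x - p) - complex.Re l * (y - t) = complex.Im u.
  by rewrite /u; move: (F _) (F _) l {H Hu u} => [? ?] [? ?] [? ?] /=; ring.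
have -> : complex.Re (F (x +i* y)) - complex.Re (F (p +i* t))
  - complex.Re l * (x - p) - (- complex.Im l) * (y - t) = complex.Re u.
  by rewrite /u; move: (F _) (F _) l {H Hu u} => [? ?] [? ?] [? ?] /=; ring.
split; apply: le_trans Hu; [exact: Im_le_cmod|exact: Re_le_cmod].
Qed.

Lemma cexp_period (x y : R) : cexp (x +i* (y + pi *+ 2)) = cexp (x +i* y).
Proof. by rewrite /cexp /= cosD2pi sinD2pi. Qed.

(** [g (cexp (x +i* y))] is periodic in [y], so Goursat's theorem on
    [[ln m, ln r] x [0, 2 pi]] equates the averages of [Re g] on the circles
    of radii [m] and [r]. The first tends to [Re (g 0)] as [m] tends to 0,
    for which continuity at 0 suffices. *)
Lemma circle_mean_bound g r rho M : 0 < r -> r < rho ->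
  (forall z, 0 < cmod z -> cmod z < rho -> holo g z) ->
  cont_at g 0 ->
  (forall z, cmod z = r -> complex.Re (g z) <= M /\ - M <= complex.Re (g z)) ->
  complex.Re (g 0) <= M.
Proof.
move=> r0 rrho gh gc gM.
apply/ler_addgt0Pr => e e0.
have [d d0 {}gc] := gc _ e0.
set m := Num.min (d / 2) r.
have m0 : 0 < m by rewrite lt_min divr_gt0.
have mr : m <= r by rewrite ge_min lexx orbT.
have md : m < d by rewrite (@le_lt_trans _ _ (d / 2))// ?ge_min ?lexx//; lra.
pose a := ln r - ln m.
have a0 : 0 <= a by rewrite subr_ge0 ler_ln ?posrE.
have uE : ln m + a = ln r by rewrite /a addrC subrK.
pose F w := g (cexp w).
pose P x y := complex.Im (F (x +i* y)); pose Q x y := complex.Re (F (x +i* y)).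
have b0 : 0 <= pi *+ 2 :> R by rewrite mulrn_wge0// pi_ge0.
have H : closed_form_on P Q (ln m) 0 a (pi *+ 2).
  move=> p t; rewrite uE => /andP[_ pr] _.
  have Hh : holo g (cexp (p +i* t)).
    apply: gh; rewrite cmod_cexp /= ?expR_gt0//.
    by apply: le_lt_trans rrho; rewrite -(@lnK _ r) ?posrE// ler_expR.
  apply: cder_closed_form; apply: cder_comp (cder_cexp _) (holo_cder Hh).
have := goursat a0 b0 H; rewrite /circulation.
(* The horizontal sides cancel by periodicity. *)
rewrite (@itg_ext _ (ln m) _ _ (fun=> 0)); last first.
  by move=> x _; rewrite /P /F cexp_period subrr.
rewrite itg_cst ?mul0r ?subr0; last by rewrite lerDl.
move=> I0.
have : `|itg 0 (0 + pi *+ 2) (fun y => Q (ln m + a) y - Q (ln m) y)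
    - (- complex.Re (g 0)) * (0 + pi *+ 2 - 0)| <= (M + e) * (0 + pi *+ 2 - 0).
  apply: itg_near.
  - by rewrite add0r.
  - by apply: (closed_form_contQ H); lra.
  - move=> y _; rewrite uE /Q /F.
    have [|A B] := gM (cexp (ln r +i* y)); first by rewrite cmod_cexp /= lnK.
    have := gc (cexp (ln m +i* y)); rewrite subr0 cmod_cexp /= lnK// => /(_ md) D.
    have := le_lt_trans (Re_le_cmod _) D; rewrite ReB ltr_norml ler_norml; lra.
rewrite I0 !add0r subr0 mulNr opprK normrM [`|pi *+ 2|]ger0_norm//.
have p2 : 0 < pi *+ 2 :> R by rewrite pmulrn_lgt0// pi_gt0.
by rewrite ler_pM2r//; apply: le_trans; exact: ler_norm.
Qed.

(** A rotation makes [q 0] real. The puncture at 0 lets the bound apply to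
    difference quotients. *)
Lemma punctured_mean_bound q r rho M : 0 < r -> r < rho ->
  (forall z, 0 < cmod z -> cmod z < rho -> holo q z) ->
  cont_at q 0 ->
  (forall z, cmod z = r -> cmod (q z) <= M) ->
  cmod (q 0) <= M.
Proof.
move=> r0 rr qh qc qM.
have M0 : 0 <= M.
  by apply: le_trans (qM r%:C _); rewrite ?cmod_ge0// cmod_real gtr0_norm.
have [->//|q0] := eqVneq (cmod (q 0)) 0.
have qp : 0 < cmod (q 0) by rewrite lt_def q0 cmod_ge0.
pose g z := (q 0)^* * q z.
have -> : (cmod (q 0) <= M) = (complex.Re (g 0) <= cmod (q 0) * M).
  by rewrite /g cmod_sqr_conj expr2 ler_pM2l.
apply: (@circle_mean_bound g r rho _ r0 rr).
- move=> z z0 zr; apply: cder_holo (cderZ _ (holo_cder _)); exact: qh.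
- move=> e e0; have [d d0 {}qc] := qc _ (divr_gt0 e0 qp); exists d => // y /qc.
  by rewrite /g -mulrBr cmodM cmod_conj ltr_pdivlMr// mulrC.
- move=> z /qM zM.
  have := Re_le_cmod (g z); rewrite /g cmodM cmod_conj ler_norml => /andP[A B].
  have := ler_wpM2l (cmod_ge0 (q 0)) zM; lra.
Qed.

Lemma mean_bound f z0 r rho M : 0 < r -> r < rho ->
  (forall z, cmod (z - z0) < rho -> holo f z) ->
  (forall z, cmod (z - z0) = r -> cmod (f z) <= M) ->
  cmod (f z0) <= M.
Proof.
move=> r0 rr fh fM; rewrite -[z0]addr0.
have sh z : cder (fun w => z0 + w) z 1.
  by rewrite -[1]add0r; apply: cderD; [exact: cder_cst|exact: cder_id].
have H z : cmod z < rho -> holo (fun w => f (z0 + w)) z.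
  move=> zr; apply: cder_holo (cder_comp (sh _) (holo_cder _)).
  by apply: fh; rewrite addrC addKr.
apply: (@punctured_mean_bound (fun w => f (z0 + w)) r rho _ r0 rr).
- by move=> z _; exact: H.
- by apply: holo_cont_at; apply: H; rewrite cmod0 (lt_trans r0).
- by move=> z zr; apply: fM; rewrite addrC addKr.
Qed.

(** The difference quotient [q] of [f] at [z0] extends continuously by the
    derivative, which its mean value bound on the circle controls. *)
Theorem cauchy_estimate f z0 r rho M : 0 < r -> r < rho ->
  (forall z, cmod (z - z0) < rho -> holo f z) ->
  (forall z, cmod (z - z0) = r -> cmod (f z - f z0) <= M) ->
  cmod (der f z0) <= M / r.
Proof.
move=> r0 rr fh fM.
pose q z := if z == 0 then der f z0 else (f (z0 + z) - f z0) / z.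
have -> : der f z0 = q 0 by rewrite /q eqxx.
have sh z : cder (fun w => z0 + w) z 1.
  by rewrite -[1]add0r; apply: cderD; [exact: cder_cst|exact: cder_id].
have H z : cmod z < rho -> holo (fun w => f (z0 + w)) z.
  move=> zr; apply: cder_holo (cder_comp (sh _) (holo_cder _)).
  by apply: fh; rewrite addrC addKr.
apply: (@punctured_mean_bound q r rho _ r0 rr).
- move=> z z0' /H/holo_cder hz.
  apply: (@cder_holo _ _ _ _ (cder_near (r := cmod z) _ _
    (cderM (cderB hz (cder_cst (f z0) z)) (cderV _ (cder_id z))))) => //.
  + move=> y yz; rewrite /q; case: eqP => // y0.
    by move: yz; rewrite y0 sub0r cmodN ltxx.
  + by rewrite -cmod_gt0.
- move=> e e0.
  have e20 : 0 < e / 2 by rewrite divr_gt0.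
  have /holo_cder/cderP/(_ _ e20)[d d0 {}H] : holo f z0.
    by apply: fh; rewrite subrr cmod0 (lt_trans r0).
  exists d => // y; rewrite subr0 => /H {}H.
  rewrite /q eqxx; case: eqP => [_|/eqP y0]; first by rewrite subrr cmod0.
  have y1 : 0 < cmod y by rewrite cmod_gt0.
  have -> : (f (z0 + y) - f z0) / y - der f z0 =
     (f (z0 + y) - f z0 - der f z0 * y) / y by field.
  rewrite cmodM cmodV ltr_pdivrMr//; apply: le_lt_trans H _.
  by rewrite ltr_pM2r//; lra.
- move=> z zr; rewrite /q ifN; last by rewrite -cmod_gt0 zr.
  rewrite cmodM cmodV zr ler_pM2r ?invr_gt0//; apply: fM.
  by rewrite addrC addKr.
Qed.
End CauchyEstimate.

(** * Compact discs *)

Section Compactness.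
Context {R : realType}.
Local Notation C := R[i].
Implicit Types (z w k l : C) (e d r : R) (f g q : C -> C).

Lemma compact_disc r : compact ([set z | cmod z <= r] : set C^o).
Proof.
pose h (p : R * R) : C^o := p.1 +i* p.2.
have hc : continuous h.
  move=> [a b]; apply/cvgC => e e0.
  have e2 : 0 < e / 2 by rewrite divr_gt0.
  exists (ball a (e / 2), ball b (e / 2)) => [|[u v] /= [au bv]].
    by split; exact: nbhsx_ballx.
  apply: (@le_lt_trans _ _ (`|u - a| + `|v - b|)).
    exact: (cmod_le_ReIm ((u +i* v) - (a +i* b))).
  by rewrite (distrC u) (distrC v); move: au bv; rewrite /ball/=; lra.
have K : compact (h @` (`[- r, r] `*` `[- r, r])).
  apply: continuous_compact; first exact: continuous_subspaceT.
  by apply: compact_setX; exact: segment_compact.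
apply: subclosed_compact K _ => [|z /= zr].
  move=> z /closureC H /=; apply/ler_addgt0Pr => e /H[y yr yz].
  have := cmodD (z - y) y; rewrite subrK cmodB => A.
  by move: yr yz A => /=; lra.
exists (complex.Re z, complex.Im z); last by case: z zr.
by split; rewrite /= in_itv/= -ler_norml (le_trans _ zr) ?Re_le_cmod ?Im_le_cmod.
Qed.

Lemma compact_closed_bounded (A : set C^o) r : closed A ->
  (forall z, A z -> cmod z <= r) -> compact A.
Proof. by move=> cA Ar; exact: subclosed_compact cA (@compact_disc r) Ar. Qed.

Lemma continuous_cmod_within f (A : set C^o) : (forall z, A z -> cont_at f z) ->
  {within A, continuous (fun z : C^o => cmod (f z) : R^o)}.
Proof.
move=> H; apply: continuous_in_subspaceT => z /[!inE] /H fz.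
have P := @cvgrPdist_lt _ R^o _ (nbhs (z : C^o)) _ (fun z => cmod (f z)) (cmod (f z)).
apply/P => e /fz[d d0 {}H].
apply/(nbhsC (z : C^o) [set y : C^o | `|cmod (f z) - cmod (f y)| < e]).
exists d => // y /H {}H /=; rewrite distrC ltr_norml.
have := cmod_sub_ge (f z) (f y); have := cmod_sub_ge (f y) (f z).
rewrite [cmod (f z - f y)]cmodB; lra.
Qed.

Lemma compact_cmod_max f (A : set C^o) : A !=set0 -> compact A ->
  (forall z, A z -> cont_at f z) ->
  exists2 c, A c & forall z, A z -> cmod (f z) <= cmod (f c).
Proof.
move=> A0 cA /continuous_cmod_within fc.
have [c cA' H] := compact_EVT_max A0 cA fc.
by exists c => [|z Az]; [rewrite inE in cA'|apply: H; rewrite inE].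
Qed.

Lemma compact_cmod_min f (A : set C^o) : A !=set0 -> compact A ->
  (forall z, A z -> cont_at f z) ->
  exists2 c, A c & forall z, A z -> cmod (f c) <= cmod (f z).
Proof.
move=> A0 cA /continuous_cmod_within fc.
have [c cA' H] := compact_EVT_min A0 cA fc.
by exists c => [|z Az]; [rewrite inE in cA'|apply: H; rewrite inE].
Qed.

Lemma bounded_on_disc f r : (forall z, cmod z <= r -> cont_at f z) ->
  exists M, forall z, cmod z <= r -> cmod (f z) <= M.
Proof.
move=> H; have [r0|r0] := leP 0 r; last first.
  by exists 0 => z zr; have := cmod_ge0 z; lra.
have [|c _ Hc] := @compact_cmod_max f [set z | cmod z <= r] _ (@compact_disc r) H.
  by exists 0; suff: cmod (0 : C) <= r by []; rewrite cmod0.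
by exists (cmod (f c)).
Qed.
End Compactness.

(** * Derivatives of holomorphic functions *)

Section HolomorphicTheory.
Context {R : realType}.
Local Notation C := R[i].
Implicit Types (z w k l : C) (e d r : R) (f g q : C -> C).

Lemma cder_shift f a z l : cder f (a + z) l -> cder (fun w => f (a + w)) z l.
Proof.
move=> fl; rewrite -[l]mulr1; apply: cder_comp fl.
by rewrite -[1]add0r; apply: cderD; [exact: cder_cst|exact: cder_id].
Qed.

Lemma der_bounded f z0 rho M : 0 < rho ->
  (forall z, cmod (z - z0) < rho -> holo f z) ->
  (forall z, cmod (z - z0) < rho -> cmod (f z) <= M) ->
  forall z r, 0 < r -> cmod (z - z0) + r < rho -> cmod (der f z) <= 2 * M / r.
Proof.
move=> rho0 fh fM z r r0 zr.
have H k : cmod (k - z) < rho - cmod (z - z0) -> cmod (k - z0) < rho.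
  by have := cmod_tri k z z0; lra.
apply: (@cauchy_estimate _ f z r (rho - cmod (z - z0))) => //; first lra.
  by move=> k /H /fh.
move=> k kz; apply: (le_trans (cmodBD _ _)).
have A : cmod (f k) <= M by apply/fM/H; rewrite kz; lra.
have B : cmod (f z) <= M by apply: fM; lra.
lra.
Qed.

(** [der f z - der f z0] is the derivative at 0 of the difference of two
    translates of [f], which the mean value inequality makes small. *)
Lemma der_lipschitz f z0 rho B : 0 < rho ->
  (forall z, cmod (z - z0) < rho -> holo f z /\ cmod (der f z) <= B) ->
  forall z, cmod (z - z0) <= rho / 2 ->
    cmod (der f z - der f z0) <= 8 * B / rho * cmod (z - z0).
Proof.
move=> rho0 H z zz.
have hh k : cmod k < rho / 2 -> cmod (z + k - z0) < rho /\ cmod (z0 + k - z0) < rho.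
  move=> kr; have := cmodD (z - z0) k; rewrite addrAC [z0 + k]addrC addrK; lra.
have D k : cmod k < rho / 2 ->
    cder (fun w => f (z + w) - f (z0 + w)) k (der f (z + k) - der f (z0 + k)).
  move=> /hh[/H[h1 _] /H[h2 _]].
  by apply: cderB; apply: cder_shift; exact: holo_cder.
have -> : der f z - der f z0 = der (fun w => f (z + w) - f (z0 + w)) 0.
  rewrite (cder_der (D 0 _)) ?addr0//; rewrite cmod0; lra.
have -> : 8 * B / rho * cmod (z - z0) = 2 * (B * cmod (z - z0)) / (rho / 4).
  by field; rewrite gt_eqF.
have mv k : cmod k < rho / 2 -> cmod (f (z + k) - f (z0 + k)) <= B * cmod (z - z0).
  move=> /hh[a b]; have := mean_value_ball H b a.
  by rewrite opprD addrACA subrr addr0.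
apply: (@cauchy_estimate _ _ 0 (rho / 4) (rho / 2)); [lra|lra| |].
- by move=> k; rewrite subr0 => /D /cder_holo.
- move=> k; rewrite subr0 => kr; apply: (le_trans (cmodBD _ _)).
  have A : cmod (f (z + k) - f (z0 + k)) <= B * cmod (z - z0) by apply: mv; lra.
  have B' : cmod (f (z + 0) - f (z0 + 0)) <= B * cmod (z - z0).
    by apply: mv; rewrite cmod0; lra.
  lra.
Qed.

Lemma holo_locally_bounded f z0 rho : 0 < rho ->
  (forall z, cmod (z - z0) < rho -> holo f z) ->
  exists d B, [/\ 0 < d, d <= rho & forall z, cmod (z - z0) < d -> cmod (der f z) <= B].
Proof.
move=> rho0 fh.
have [|d d0 H] := holo_cont_at (fh z0 _) ltr01; first by rewrite subrr cmod0.
set m := Num.min d rho; have m0 : 0 < m by rewrite lt_min d0.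
have m2 : 0 < m / 2 by rewrite divr_gt0.
exists (m / 2), (2 * (cmod (f z0) + 1) / (m / 2)); split=> //.
  have : m <= rho by rewrite ge_min lexx orbT.
  lra.
move=> z zm; apply: (der_bounded (z0 := z0) (rho := m)) => // [w|w|]; last lra.
- by rewrite lt_min => /andP[_]; exact: fh.
- rewrite lt_min => /andP[/H A _].
  have := cmodD (f w - f z0) (f z0); rewrite subrK; lra.
Qed.

(** The limit is the supremum of the lower estimates [u k - L * cmod k], each of
    which is below each upper estimate [u l + L * cmod l]. *)
Lemma limit_of_cauchy_real (u : C -> R) s (L : R) : 0 < s ->
  (forall k l, 0 < cmod k -> cmod k < s -> 0 < cmod l -> cmod l < s ->
     u k - u l <= L * (cmod k + cmod l)) ->
  exists a, forall k, 0 < cmod k -> cmod k < s -> `|u k - a| <= L * cmod k.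
Proof.
move=> s0 H.
pose E := [set u k - L * cmod k | k in [set k | 0 < cmod k /\ cmod k < s]].
have E0 : E !=set0.
  have E2 : cmod (s / 2)%:C = s / 2 by rewrite cmod_real gtr0_norm ?divr_gt0.
  exists (u (s / 2)%:C - L * cmod (s / 2)%:C), (s / 2)%:C => //.
  by split; rewrite E2; lra.
have U l : 0 < cmod l -> cmod l < s -> ubound E (u l + L * cmod l).
  by move=> l0 ls _ [k [k0 ks] <-]; have := H _ _ k0 ks l0 ls; lra.
exists (sup E) => k k0 ks; rewrite ler_norml.
have : u k - L * cmod k <= sup E.
  apply: ub_le_sup; last by exists k.
  by exists (u k + L * cmod k); exact: U.
have : sup E <= u k + L * cmod k by apply: ge_sup => //; exact: U.
lra.
Qed.

Lemma limit_of_cauchy (G : C -> C) s (L : R) : 0 < s ->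
  (forall k l, 0 < cmod k -> cmod k < s -> 0 < cmod l -> cmod l < s ->
     cmod (G k - G l) <= L * (cmod k + cmod l)) ->
  exists a, forall k, 0 < cmod k -> cmod k < s -> cmod (G k - a) <= 2 * L * cmod k.
Proof.
move=> s0 H.
have [|a Ha] := @limit_of_cauchy_real (fun k => complex.Re (G k)) s L s0.
  move=> k l k0 ks l0 ls; apply: le_trans (H _ _ k0 ks l0 ls).
  by rewrite -ReB; apply: le_trans (Re_le_cmod _); exact: ler_norm.
have [|b Hb] := @limit_of_cauchy_real (fun k => complex.Im (G k)) s L s0.
  move=> k l k0 ks l0 ls; apply: le_trans (H _ _ k0 ks l0 ls).
  have -> : complex.Im (G k) - complex.Im (G l) = complex.Im (G k - G l).
    by case: (G k) (G l) => [? ?] [? ?].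
  by apply: le_trans (Im_le_cmod _); exact: ler_norm.
exists (a +i* b) => k k0 ks; apply: (le_trans (cmod_le_ReIm _)).
have := Ha _ k0 ks; have := Hb _ k0 ks; case: (G k) => x y /=; lra.
Qed.

(** The difference quotients of [f] are holomorphic and converge uniformly, so by
    Cauchy's estimate their derivatives at [z0], which are the difference
    quotients of [der f], converge as well. *)
Theorem holo_der f z0 rho : 0 < rho ->
  (forall z, cmod (z - z0) < rho -> holo f z) -> holo (der f) z0.
Proof.
move=> rho0 fh0.
have [d [B [d0 drho HB]]] := holo_locally_bounded rho0 fh0.
have B0 : 0 <= B by apply: le_trans (HB z0 _); rewrite ?cmod_ge0// subrr cmod0.
have fh z : cmod (z - z0) < d -> holo f z /\ cmod (der f z) <= B.
  by move=> zd; split; [apply: fh0; lra|exact: HB].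
set L := 8 * B / (d / 2).
have L0 : 0 <= L by rewrite divr_ge0 ?mulr_ge0//; lra.
have lip z w : cmod (z - z0) < d / 2 -> cmod (w - z) <= d / 4 ->
    cmod (der f w - der f z) <= L * cmod (w - z).
  move=> zd wz; apply: (@der_lipschitz _ _ (d / 2)); [lra| |lra].
  by move=> k kz; apply: fh; have := cmod_tri k z z0; lra.
(* The difference quotients [D k] converge to [der f] uniformly near [z0], at
   a rate linear in [cmod k]. *)
pose D k z := (f (z + k) - f z) / k.
have Dl k z : 0 < cmod k -> cmod k < d / 8 -> cmod (z - z0) < d / 4 ->
    cmod (D k z - der f z) <= L * cmod k.
  move=> k0 kd zd.
  have hz y : cmod (y - z) < d / 8 -> cder (fun w => f w - der f z * w) y (der f y - der f z).
    move=> yz; apply: cderB.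
      by apply: holo_cder; apply: (fh _ _).1; have := cmod_tri y z z0; lra.
    by rewrite -[der f z in X in cder _ _ X]mulr1; apply: cderZ; exact: cder_id.
  have := @mean_value_le _ (fun w => f w - der f z * w) z k (L * cmod k).
  have -> : f (z + k) - der f z * (z + k) - (f z - der f z * z) = k * (D k z - der f z).
    by rewrite /D; field; rewrite -cmod_gt0.
  rewrite cmodM [cmod k * _]mulrC ler_pM2r//; apply => t /andP[t0 t1].
  have tk : cmod (t%:C * k) <= cmod k.
    by rewrite cmodM cmod_real ger0_norm// ler_piMl// cmod_ge0.
  have tz : cmod (z + t%:C * k - z) <= cmod k by rewrite addrAC subrr add0r.
  have := hz (z + t%:C * k) (le_lt_trans tz kd) => hk.
  split; first exact: cder_holo hk.
  rewrite (cder_der hk); apply: (@le_trans _ _ (L * cmod (z + t%:C * k - z))).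
    by apply: lip; lra.
  by rewrite ler_wpM2l.
have Dd k z : cmod k < d / 8 -> cmod (z - z0) < d / 4 ->
    cder (D k) z ((der f (z + k) - der f z) / k).
  move=> kd zd; rewrite /D.
  have E : cder (fun w => k^-1 * (f (k + w) - f w)) z
     (k^-1 * (der f (k + z) - der f z)).
    apply: cderZ; apply: cderB; last by apply: holo_cder; apply: (fh _ _).1; lra.
    apply: cder_shift; apply: holo_cder; apply: (fh _ _).1.
    by have := cmodD k (z - z0); rewrite addrA; lra.
  have -> : (fun w => (f (w + k) - f w) / k) = (fun w => k^-1 * (f (k + w) - f w)).
    by apply/funext => w; rewrite mulrC [k + w]addrC.
  by rewrite [z + k]addrC [_ / k]mulrC.
(* Cauchy's estimate turns that rate into a Cauchy condition on the
   derivatives of the [D k] at [z0]. *)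
have [||a Ha] := @limit_of_cauchy (fun k => (der f (z0 + k) - der f z0) / k)
  (d / 8) (16 * L / d).
- lra.
- move=> k l k0 kd l0 ld.
  have z00 : cmod (z0 - z0) < d / 4 by rewrite subrr cmod0; lra.
  have E := cderB (Dd k z0 kd z00) (Dd l z0 ld z00).
  rewrite -(cder_der E).
  have -> : 16 * L / d * (cmod k + cmod l) = 2 * (L * (cmod k + cmod l)) / (d / 8).
    by field; rewrite gt_eqF.
  apply: (@cauchy_estimate _ _ z0 (d / 8) (d / 4)); [lra|lra| |].
    by move=> z zd; apply: cder_holo (cderB (Dd k z kd zd) (Dd l z ld zd)).
  move=> z zd; apply: (le_trans (cmodBD _ _)).
  have zd4 : cmod (z - z0) < d / 4 by lra.
  have DD y : cmod (y - z0) < d / 4 -> cmod (D k y - D l y) <= L * (cmod k + cmod l).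
    move=> yd; apply: (le_trans (cmod_tri _ (der f y) _)).
    by rewrite mulrDr; apply: lerD; rewrite ?[cmod (der f y - _)]cmodB; exact: Dl.
  have := DD _ zd4; have := DD _ z00; lra.
apply: (@cder_holo _ _ _ a); apply/cderP => e e0.
have K0 : 0 < 2 * (16 * L / d) + 1.
  have : 0 <= 16 * L / d by apply: divr_ge0; lra.
  lra.
exists (Num.min (d / 8) (e / (2 * (16 * L / d) + 1))).
  by rewrite lt_min !divr_gt0.
move=> k; rewrite lt_min => /andP[kd]; rewrite ltr_pdivlMr// => ke.
have [->|kn] := eqVneq k 0; first by rewrite addr0 mulr0 !subrr cmod0 mulr0.
have k0 : 0 < cmod k by rewrite cmod_gt0.
have -> : der f (z0 + k) - der f z0 - a * k = ((der f (z0 + k) - der f z0) / k - a) * k.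
  by rewrite mulrBl divfK.
rewrite cmodM; apply: ler_wpM2r; first exact: cmod_ge0.
apply: (le_trans (Ha _ k0 kd)).
by move: ke; rewrite mulrDr mulr1 [cmod k * _]mulrC; lra.
Qed.
End HolomorphicTheory.

(** * Entire functions *)

Section EntireFunctions.
Context {R : realType}.
Local Notation C := R[i].
Implicit Types (z w l : C) (e d r : R) (f g q : C -> C).

(** On a disc of radius [r] the derivative is at most [4 * K] in modulus, and
    its Lipschitz constant of order [K / r] tends to 0 along the given radii:
    the derivative is constant. *)
Lemma entire_affine f (K : R) : (forall z, holo f z) ->
  (forall r0, exists2 r, r0 <= r & forall z, cmod z < r -> cmod (f z) <= K * r) ->
  forall z, f z = f 0 + der f 0 * z.
Proof.
move=> fh H.
have dconst z : der f z = der f 0.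
  apply/eqP; rewrite -subr_eq0 -cmod_eq0 eq_le cmod_ge0 andbT.
  apply/ler_addgt0Pr => e e0; rewrite add0r.
  set A := 64 * K * cmod z.
  have [r rr fr] := H (Num.max 1 (Num.max (4 * cmod z) (A / e))).
  move: rr; rewrite !ge_max => /and3P[r1 rz re].
  have r0 : 0 < r by lra.
  have B y : cmod (y - 0) < r / 2 -> holo f y /\ cmod (der f y) <= 4 * K.
    rewrite subr0 => yr; split; first exact: fh.
    have -> : 4 * K = 2 * (K * r) / (r / 2) by field; rewrite gt_eqF.
    apply: (@der_bounded _ f 0 r) => //; rewrite ?subr0; try lra.
    by move=> y'; rewrite subr0; exact: fr.
  have r2 : 0 < r / 2 by lra.
  have zr : cmod (z - 0) <= r / 2 / 2 by rewrite subr0; lra.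
  apply: (le_trans (der_lipschitz r2 B zr)); rewrite subr0.
  have -> : 8 * (4 * K) / (r / 2) * cmod z = A / r by rewrite /A; field; rewrite gt_eqF.
  by rewrite ler_pdivrMr// mulrC -ler_pdivrMr.
move=> z.
have D y : cder (fun w => f w - der f 0 * w) y 0.
  have := cderB (holo_cder (fh y)) (cderZ (der f 0) (cder_id y)).
  by rewrite mulr1 dconst subrr.
have := @mean_value_le _ (fun w => f w - der f 0 * w) 0 z 0.
rewrite mul0r add0r mulr0 subr0 => /(_ _)/wrap[t _|].
  by rewrite (cder_der (D _)) cmod0; split=> //; exact: cder_holo (D _).
move=> le0; have : cmod (f z - der f 0 * z - f 0) == 0 by rewrite eq_le le0 cmod_ge0.
by rewrite cmod_eq0 !subr_eq0 subr_eq addrC => /eqP.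
Qed.

Definition quot g z := if z == 0 then der g 0 else g z / z.

Lemma quotE g z : g 0 = 0 -> g z = z * quot g z.
Proof.
move=> g0; rewrite /quot; case: eqP => [->|/eqP z0]; first by rewrite mul0r.
by rewrite mulrC divfK.
Qed.

(** At 0 the second derivative [m] of [g] gives the expansion
    [g k = der g 0 * k + m / 2 * k ^+ 2 + o (k ^+ 2)]. *)
Lemma holo_quot g : (forall z, holo g z) -> g 0 = 0 ->
  forall z, holo (quot g) z.
Proof.
move=> gh g0 z; have [->|z0] := eqVneq z 0; last first.
  have zp : 0 < cmod z by rewrite cmod_gt0.
  apply: cder_holo (cder_near (r := cmod z) zp _
    (cderM (holo_cder (gh z)) (cderV z0 (cder_id z)))).
  move=> y yz; rewrite /quot; case: eqP => // y0.
  by move: yz; rewrite y0 sub0r cmodN ltxx.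
have /holo_cder : holo (der g) 0 by apply: (@holo_der _ g 0 1) => //.
move: (der (der g) 0) => m /cderP H.
apply: (@cder_holo _ _ _ (m / 2)); apply/cderP => e e0.
have [d d0 {}H] := H _ e0.
exists d => // k kd; rewrite add0r.
have [->|k0] := eqVneq k 0; first by rewrite mulr0 subrr subr0 cmod0 mulr0.
have kp : 0 < cmod k by rewrite cmod_gt0.
rewrite /quot eqxx (negbTE k0).
have D y : cder (fun w => g w - der g 0 * w - m / 2 * (w * w)) y
    (der g y - der g 0 - m * y).
  have := cderB (cderB (holo_cder (gh y)) (cderZ (der g 0) (cder_id y)))
    (cderZ (m / 2) (cderM (cder_id y) (cder_id y))).
  have -> // : der g y - der g 0 * 1 - m / 2 * (y * 1 + y * 1) =
    der g y - der g 0 - m * y.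
  by move: (der g y) (der g 0) => u v; field.
have := @mean_value_le _ (fun w => g w - der g 0 * w - m / 2 * (w * w)) 0 k (e * cmod k).
have -> : g (0 + k) - der g 0 * (0 + k) - m / 2 * ((0 + k) * (0 + k)) -
  (g 0 - der g 0 * 0 - m / 2 * (0 * 0)) = (g k / k - der g 0 - m / 2 * k) * k.
  by rewrite g0 !add0r; move: (der g 0) (g k) => u v; field.
rewrite cmodM ler_pM2r//; apply => t /andP[t0 t1]; split; first exact: cder_holo (D _).
have tk : cmod (t%:C * k) <= cmod k.
  by rewrite cmodM cmod_real ger0_norm// ler_piMl// cmod_ge0.
rewrite (cder_der (D _)) add0r.
have := H (t%:C * k) (le_lt_trans tk kd); rewrite add0r => /le_trans; apply.
by rewrite ler_wpM2l// ltW.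
Qed.

(** Dividing [g] by the variable as long as the quotient vanishes at 0 must
    stop, after which [g] is a power of the variable times a function that
    does not vanish near 0. *)
Lemma isolated_zero g : (forall z, holo g z) -> g 0 = 0 ->
  (exists z, g z != 0) ->
  exists2 d, 0 < d & forall z, 0 < cmod z -> cmod z < d -> g z != 0.
Proof.
move=> gh g0 [z gz].
pose G n := iter n quot g.
have GS n : G n.+1 = quot (G n) by [].
(* If every quotient vanished at 0, then [g z = z ^+ n * G n z] for all [n]. On
   the circle of radius [3 * cmod z] about [z] the variable has modulus at least
   [2 * cmod z], so the mean value bound at [z] gives
   [cmod (g z) <= M / 2 ^+ n]. *)
have [n Gn0] : exists n, G n 0 != 0.
  apply: contrapT => H; have G0 n : G n 0 = 0.
    by apply/eqP; apply: contrapT => /negP ?; apply: H; exists n.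
  have Gh n : forall w, holo (G n) w.
    by elim: n => [//|n IH]; rewrite GS; apply: holo_quot.
  have GE n w : g w = w ^+ n * G n w.
    elim: n => [|n IH]; first by rewrite expr0 mul1r.
    by rewrite IH (quotE _ (G0 n)) -GS exprSr mulrA.
  have z0 : z != 0 by apply: contraNneq gz => ->; rewrite g0.
  have zp : 0 < cmod z by rewrite cmod_gt0.
  have [M HM] := @bounded_on_disc _ g (4 * cmod z) (fun w _ => holo_cont_at (gh w)).
  have gp : 0 < cmod (g z) by rewrite cmod_gt0.
  have B n : cmod (g z) <= M / 2 ^+ n.
    have -> : M / 2 ^+ n = cmod z ^+ n * (M / (2 * cmod z) ^+ n).
      by rewrite exprMn; field; rewrite !expf_neq0// gt_eqF.
    rewrite (GE n z) cmodM cmodX ler_wpM2l ?exprn_ge0 ?cmod_ge0//.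
    apply: (@mean_bound _ (G n) z (3 * cmod z) (4 * cmod z)); [lra|lra| |].
      by move=> w _; exact: Gh.
    move=> w wz.
    have w2 : 2 * cmod z <= cmod w by have := cmodBD w z; lra.
    have w4 : cmod w <= 4 * cmod z by have := cmodD (w - z) z; rewrite subrK; lra.
    have wp : 0 < cmod w by lra.
    have := HM _ w4; rewrite (GE n w) cmodM cmodX => HMw.
    rewrite ler_pdivlMr ?exprn_gt0//; last by lra.
    apply: le_trans HMw; rewrite mulrC ler_wpM2r ?cmod_ge0//.
    by rewrite lerXn2r// nnegrE; lra.
  have M0 : 0 < M by have := B 0%N; rewrite expr0 divr1; lra.
  have := B (Num.truncn (M / cmod (g z))).+1.
  rewrite leNgt => /negP; apply.
  rewrite ltr_pdivrMr ?exprn_gt0// mulrC -ltr_pdivrMr//.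
  apply: (lt_le_trans (truncnS_gt _)).
  by rewrite -natrX ler_nat ltnW// ltn_expl.
have : exists n, G n 0 != 0 by exists n.
move=> /ex_minnP[{Gn0}{}n Gn0 nmin].
have G0 k : (k < n)%N -> G k 0 = 0.
  by move=> kn; apply/eqP; apply: contraTT kn => /nmin; rewrite -leqNgt.
have Gh k : (k <= n)%N -> forall w, holo (G k) w.
  elim: k => [//|k IH] kn; rewrite GS.
  by apply: holo_quot (G0 _ kn) => w; apply: IH; exact: ltnW.
have GE k w : (k <= n)%N -> g w = w ^+ k * G k w.
  elim: k => [|k IH] kn; first by rewrite expr0 mul1r.
  by rewrite IH ?(ltnW kn)// (quotE _ (G0 k kn)) -GS exprSr mulrA.
have gp : 0 < cmod (G n 0) by rewrite cmod_gt0.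
have [d d0 H] := holo_cont_at (Gh n (leqnn n) 0) gp.
exists d => // w w0 wd; rewrite (GE n w (leqnn n)) mulf_eq0 expf_eq0.
rewrite -[w == 0]cmod_eq0 gt_eqF// andbF /=; apply/eqP => Gw.
by have := H w; rewrite subr0 Gw sub0r cmodN ltxx => /(_ wd).
Qed.

Lemma compact_circle z0 r : compact ([set z | cmod (z - z0) = r] : set C^o).
Proof.
apply: (@compact_closed_bounded _ _ (cmod z0 + r)) => [z /closureC H /=|z /= zr].
  apply/eqP; rewrite -subr_eq0 -normr_eq0 eq_le normr_ge0 andbT.
  apply/ler_addgt0Pr => e e0; rewrite add0r.
  have [y /= yr yz] := H _ e0.
  have := cmod_tri z y z0; have := cmod_tri y z z0; rewrite (cmodB z y) yr ler_norml.
  lra.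
by have := cmodD (z - z0) z0; rewrite subrK; lra.
Qed.

(** By isolation of values [f - f z0] is bounded away from 0 on a small circle;
    a value near [f z0] that is missed inside contradicts the mean value bound
    for [1 / (f - w)]. *)
Theorem open_mapping f : (forall z, holo f z) -> ~ (exists a, forall z, f z = a) ->
  forall U : set C^o, open U -> open (f @` U : set C^o).
Proof.
move=> fh fnc U /openC oU; apply/openC => _ [z0 Uz0 <-].
have [d1 d10 Hd1] := oU _ Uz0.
have [d2 d20 Hd2] : exists2 d, 0 < d & forall z, 0 < cmod z -> cmod z < d ->
   f (z0 + z) - f z0 != 0.
  apply: isolated_zero.
  - move=> z; apply: cder_holo (cderB (cder_shift _) (cder_cst (f z0) z)).
    by apply: holo_cder; exact: fh.
  - by rewrite addr0 subrr.
  - apply: contrapT => H; apply: fnc; exists (f z0) => z.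
    apply/eqP; rewrite -subr_eq0; apply: contrapT => /negP Hz; apply: H.
    by exists (z - z0); rewrite [z0 + _]addrC subrK.
set rho := Num.min d1 d2; have rho0 : 0 < rho by rewrite lt_min d10.
have r0 : 0 < rho / 2 by lra.
have [||c cr Hc] := @compact_cmod_min _ (fun z => f z - f z0) _ _
  (@compact_circle z0 (rho / 2)).
- exists (z0 + (rho / 2)%:C); suff : cmod (z0 + (rho / 2)%:C - z0) = rho / 2 by [].
  by rewrite addrAC subrr add0r cmod_real gtr0_norm.
- move=> z _; apply: cder_cont_at (cderB (holo_cder (fh z)) (cder_cst (f z0) z)).
move: cr => /= cr.
have m0 : 0 < cmod (f c - f z0).
  rewrite cmod_gt0 -[c](subrK z0) [_ - _ + _]addrC; apply: Hd2; rewrite ?cr//.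
  have : rho <= d2 by rewrite ge_min lexx orbT.
  lra.
move: Hc m0; set m := cmod (f c - f z0) => Hc m0.
exists (m / 2); first lra.
move=> w wm; apply: contrapT => wU.
(* A missed value [w] makes [1 / (f - w)] holomorphic, yet larger at [z0] than
   on the circle where [f - f z0] has modulus at least [m]. *)
have fw z : cmod (z - z0) < rho -> f z - w != 0.
  rewrite lt_min => /andP[zd _]; rewrite subr_eq0; apply/eqP => E.
  by apply: wU; exists z => //; exact: Hd1.
have : cmod ((f z0 - w)^-1) <= (m / 2)^-1.
  apply: (@mean_bound _ (fun z => (f z - w)^-1) z0 (rho / 2) rho); [lra|lra| |].
    move=> z /fw zw.
    by apply: cder_holo (@cderV _ (fun z => f z - w) _ _ zw (cderB (holo_cder (fh z)) (cder_cst w z))).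
  move=> z zr; rewrite cmodV lef_pV2 ?posrE; [|by rewrite cmod_gt0 fw// zr; lra|lra].
  have := Hc z zr; have := cmod_tri (f z) w (f z0); lra.
have wz0 : 0 < cmod (f z0 - w) by rewrite cmod_gt0 fw// subrr cmod0.
rewrite cmodV lef_pV2 ?posrE//; last lra.
rewrite cmodB; lra.
Qed.
End EntireFunctions.

(** * Quantitative inversion *)

Section Covering.
Context {R : realType}.
Local Notation C := R[i].
Implicit Types (z w l : C) (e d r s : R) (f g h q : C -> C).

Lemma holo_cst a z : holo (fun=> a : C) z.
Proof. exact: cder_holo (cder_cst a z). Qed.

Lemma holoD f g z : holo f z -> holo g z -> holo (fun w => f w + g w) z.
Proof. by move=> /holo_cder fz /holo_cder gz; exact: cder_holo (cderD fz gz). Qed.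

Lemma holoB f g z : holo f z -> holo g z -> holo (fun w => f w - g w) z.
Proof. by move=> /holo_cder fz /holo_cder gz; exact: cder_holo (cderB fz gz). Qed.

Lemma holo_div f g z : holo f z -> holo g z -> g z != 0 ->
  holo (fun w => f w / g w) z.
Proof.
by move=> /holo_cder fz /holo_cder gz z0; exact: cder_holo (cderM fz (cderV z0 gz)).
Qed.

Lemma holo_comp f g z : holo f (g z) -> holo g z -> holo (fun w => f (g w)) z.
Proof. by move=> /holo_cder fz /holo_cder gz; exact: cder_holo (cder_comp gz fz). Qed.

Lemma holo_scale f (a : C) z : holo f (a * z) -> holo (fun w => f (a * w)) z.
Proof.
by move=> /holo_comp; apply; exact: cder_holo (cderZ a (cder_id z)).
Qed.

(** [f] is the linear map of slope [c] up to a perturbation whose Lipschitz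
    constant is half as large. *)
Lemma expansion f z0 s c :
  (forall z, cmod (z - z0) < s -> holo f z /\ cmod (der f z - c) <= cmod c / 2) ->
  forall x y : C, cmod (x - z0) < s -> cmod (y - z0) < s ->
    cmod c / 2 * cmod (y - x) <= cmod (f y - f x).
Proof.
move=> H x y xs ys.
have D z : cmod (z - z0) < s -> cder (fun w => f w - c * w) z (der f z - c).
  move=> /H[hz _]; rewrite -[c in der f z - c]mulr1.
  by apply: cderB; [exact: holo_cder|apply: cderZ; exact: cder_id].
have H' z : cmod (z - z0) < s ->
    holo (fun w => f w - c * w) z /\ cmod (der (fun w => f w - c * w) z) <= cmod c / 2.
  move=> zs; rewrite (cder_der (D _ zs)).
  by split; [exact: cder_holo (D _ zs)|exact: (H z zs).2].
have := mean_value_ball H' xs ys.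
have -> : f y - c * y - (f x - c * x) = (f y - f x) - c * (y - x) by ring.
have := cmod_tri (c * (y - x)) (f y - f x) 0.
rewrite !subr0 cmodM [cmod (c * _ - _)]cmodB; lra.
Qed.

(** A point of the closed disc of radius [s / 2] that minimizes [cmod (f z - w)]
    must be a solution. *)
Theorem covering f z0 s c : 0 < s -> c != 0 ->
  (forall z, cmod (z - z0) < s -> holo f z /\ cmod (der f z - c) <= cmod c / 2) ->
  forall w, cmod (w - f z0) < cmod c * s / 8 -> exists2 z, cmod (z - z0) < s & f z = w.
Proof.
move=> s0 c0 H w ws.
have cp : 0 < cmod c by rewrite cmod_gt0.
have K : compact ([set z | cmod (z - z0) <= s / 2] : set C^o).
  apply: (@compact_closed_bounded _ _ (cmod z0 + s / 2)) => [z /closureC cz /=|z /= zs].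
    apply/ler_addgt0Pr => e /cz[y /= ys yz].
    have := cmod_tri z y z0; rewrite (cmodB z y); lra.
  by have := cmodD (z - z0) z0; rewrite subrK; lra.
have z0s : cmod (z0 - z0) <= s / 2 by rewrite subrr cmod0; lra.
have [||m /= ms Hm] := @compact_cmod_min _ (fun z => f z - w) _ _ K.
- by exists z0.
- move=> z zs; apply: holo_cont_at; apply: holoB; last exact: holo_cst.
  by apply: (H z _).1; move: zs => /=; lra.
have ms' : cmod (m - z0) < s by lra.
exists m => //; apply/eqP; rewrite -subr_eq0; apply: contraT => fm.
have fmp : 0 < cmod (f m - w) by rewrite cmod_gt0.
(* By expansion, [f] is too far from [w] on the boundary circle. *)
have mi : cmod (m - z0) < s / 2.
  rewrite lt_neqAle ms andbT; apply/eqP => E.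
  have := @expansion f z0 s c H z0 m (le_lt_trans z0s _) ms'.
  rewrite E => /(_ _)/wrap[|A]; first lra.
  have := Hm z0 z0s; have := cmod_tri (f m) w (f z0); rewrite [cmod (f z0 - w)]cmodB.
  move: A ws; nra.
(* A step [k] along which the linear part of [f] moves straight towards [w]
   decreases the minimum, since the derivative at [m] is nonzero. *)
have [hm dm] := H m ms'.
set l := der f m in dm.
have l0 : 0 < cmod l.
  have := cmod_sub_ge c (c - l); rewrite opprB addrCA subrr addr0 [cmod (c - l)]cmodB; lra.
have e0 : 0 < cmod l / 2 by lra.
have [d d0 Hd] := (cderP _ _ _).1 (holo_cder hm) _ e0.
set D := cmod (f m - w) / cmod l.
have D0 : 0 < D by rewrite divr_gt0.
set M := Num.min d (s / 2 - cmod (m - z0)).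
have M0 : 0 < M by rewrite lt_min d0; lra.
set t := Num.min 1 (M / (2 * D)).
have t0 : 0 < t by rewrite lt_min ltr01 divr_gt0// mulr_gt0.
have t1 : t <= 1 by rewrite ge_min lexx.
have tD0 : 0 < t * D by rewrite mulr_gt0.
have tM : t * D < M.
  have : t <= M / (2 * D) by rewrite ge_min lexx orbT.
  have D20 : 0 < 2 * D by rewrite mulr_gt0// ltr0n.
  rewrite (ler_pdivlMr _ _ D20) mulrCA; move: (t * D) tD0 => u; lra.
pose k := - (t%:C * ((f m - w) / l)).
have nk : cmod k = t * D by rewrite cmodN cmodM cmod_real gtr0_norm// cmodM cmodV.
have kd : cmod k < d by rewrite nk; apply: lt_le_trans tM _; rewrite ge_min lexx.
have ks : cmod (m + k - z0) <= s / 2.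
  have : t * D < s / 2 - cmod (m - z0) by apply: lt_le_trans tM _; rewrite ge_min lexx orbT.
  have := cmodD (m - z0) k; rewrite nk addrAC; lra.
have := Hm _ ks; rewrite leNgt => /negP; case.
have := Hd _ kd; rewrite -/l nk.
have -> : cmod l / 2 * (t * D) = t / 2 * cmod (f m - w) by rewrite /D; field; rewrite gt_eqF.
have -> : f (m + k) - f m - l * k = f (m + k) - w - (1 - t%:C) * (f m - w).
  by rewrite /k; move: (f (m + k)) (f m) => u v; field; rewrite -cmod_gt0.
have -> : 1 - t%:C = (1 - t)%:C by rewrite rmorphB rmorph1.
have := cmod_tri (f (m + k) - w) ((1 - t)%:C * (f m - w)) 0.
rewrite !subr0 cmodM cmod_real ger0_norm ?subr_ge0//; nra.
Qed.

(** Inverting [cexp] near 0, where its derivative is close to 1; the inverse is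
    Lipschitz by expansion, hence differentiable. *)
Lemma local_log : exists2 eta : R, 0 < eta & exists L : C -> C,
  forall w, cmod (w - 1) < eta -> cexp (L w) = w /\ holo L w.
Proof.
have [||s s0 Hs] := @holo_cont_at R cexp 0 _ (2^-1).
- exact: cder_holo (cder_cexp 0).
- by rewrite invr_gt0.
have H z : cmod (z - 0) < s -> holo cexp z /\ cmod (der cexp z - 1) <= cmod (1 : C) / 2.
  move=> zs; split; first exact: cder_holo (cder_cexp z).
  rewrite (cder_der (cder_cexp z)) cmod1 mul1r ltW//.
  by rewrite -[1]cexp0; exact: Hs.
have cov := covering s0 (oner_neq0 C) H.
exists (s / 8); first by lra.
have /choice[L HL] : forall w : C, exists z : C,
    cmod (w - 1) < s / 8 -> cmod (z - 0) < s /\ cexp z = w.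
  move=> w; have [ws|nws] := pselect (cmod (w - 1) < s / 8); last by exists 0.
  by have [|z zs zw] := cov w; [rewrite cexp0 cmod1 mul1r|exists z].
exists L => w ws; have [Lw ew] := HL w ws; split=> //.
have w0 : 0 < cmod w by rewrite cmod_gt0 -ew cexp_neq0.
apply: (@cder_holo _ _ _ (w^-1)); apply/cderP => e e0.
have e'0 : 0 < e * cmod w / 2 by rewrite divr_gt0// mulr_gt0.
have [d d0 Hd] := (cderP _ _ _).1 (cder_cexp (L w)) _ e'0.
exists (Num.min (d / 2) (s / 8 - cmod (w - 1))); first by rewrite lt_min; lra.
move=> k; rewrite lt_min => /andP[kd ks].
have [|Lk ek] := HL (w + k).
  by have := cmodD (w - 1) k; rewrite addrAC; lra.
set j := L (w + k) - L w.
have jk : cmod j <= 2 * cmod k.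
  have := expansion H Lw Lk.
  by rewrite ek ew cmod1 addrAC subrr add0r -/j; lra.
have jd : cmod j < d by lra.
have := Hd _ jd; rewrite /j [L w + _]addrC subrK ek ew [w + k - w]addrAC subrr add0r -/j => A.
have -> : j - w^-1 * k = - (k - w * j) / w by field; rewrite -cmod_gt0.
rewrite cmodM cmodN cmodV ler_pdivrMr//; apply: (le_trans A).
have := ler_wpM2l (ltW e'0) jk; lra.
Qed.
End Covering.

(** * The Bloch-Landau theorem and missed sets *)

Section LargeCovering.
Context {R : realType}.
Local Notation C := R[i].
Implicit Types (z w l : C) (e d r s : R) (f g h q : C -> C).

Lemma entire_lipschitz f s : (forall z, holo f z) ->
  exists2 B, 0 < B & forall x y : C, cmod x < s -> cmod y < s ->
    cmod (f y - f x) <= B * cmod (y - x).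
Proof.
move=> fh.
have dh z : holo (der f) z by apply: (@holo_der _ f z 1) => //.
have [B HB] := @bounded_on_disc _ (der f) s (fun z _ => holo_cont_at (dh z)).
exists (`|B| + 1) => [|x y xs ys]; first by rewrite ltr_wpDl.
apply: (@mean_value_ball _ f 0 s); rewrite ?subr0// => z zs; split; first exact: fh.
rewrite subr0 in zs; have := HB z (ltW zs); have := ler_norm B; lra.
Qed.

(** [g z] is the product of [g 0] and the ratios of consecutive values of [g]
    along the segment from 0 to [z]. For a fine subdivision the ratios lie in
    the domain of the local logarithm, uniformly in [z]. *)
Theorem log_branch g rho s : s < rho -> 0 < s -> (forall z, holo g z) ->
  (forall z, cmod z < rho -> g z != 0) ->
  exists h, forall z, cmod z < s -> holo h z /\ cexp (h z) = g z.
Proof.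
move=> srho s0 gh g0.
have [eta eta0 [L HL]] := @local_log R.
have [B B0 HB] := entire_lipschitz rho gh.
have [||c /= cs Hc] := @compact_cmod_min _ g _ _ (@compact_disc _ s).
- by exists 0; suff : cmod (0 : C) <= s by []; rewrite cmod0 ltW.
- by move=> z _; exact: holo_cont_at.
set m := cmod (g c).
have m0 : 0 < m by rewrite cmod_gt0 g0// (le_lt_trans cs).
set n := (Num.truncn (B * s / m / eta)).+1.
have n0 : 0 < n%:R :> R by rewrite ltr0n.
have nB : B * s / m / eta < n%:R by exact: truncnS_gt.
pose a (j : nat) : C := (j%:R / n%:R)%:C.
have a01 j : (j <= n)%N -> 0 <= (j%:R / n%:R : R) <= 1.
  by move=> jn; rewrite divr_ge0 ?ler0n//= ler_pdivrMr// mul1r ler_nat.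
have aS j z : (j <= n)%N -> cmod z < s -> cmod (a j * z) < s.
  move=> /a01/andP[j0 j1] zs; rewrite cmodM cmod_real ger0_norm//.
  by apply: le_lt_trans zs; rewrite ler_piMl ?cmod_ge0.
have ga j z : (j <= n)%N -> cmod z < s -> g (a j * z) != 0.
  by move=> jn zs; apply: g0; apply: lt_trans srho; exact: aS.
have gah j z : holo (fun w => g (a j * w)) z by apply: holo_scale; exact: gh.
have [|L0 HL0 _] := @cexp_polar _ (g 0); first by apply: g0; rewrite cmod0 (lt_trans s0).
(* The branch is continued along the [n] contracted discs [a j * disc]. *)
have H j : (j <= n)%N -> exists h, forall z, cmod z < s ->
    holo h z /\ cexp (h z) = g (a j * z).
  elim: j => [_|j IH jn].
    exists (fun=> L0) => z _; split; first exact: holo_cst.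
    by rewrite HL0 /a mul0r rmorph0 mul0r.
  have [h Hh] := IH (ltnW jn).
  exists (fun z => h z + L (g (a j.+1 * z) / g (a j * z))) => z zs.
  have [hz ez] := Hh z zs.
  have gj := ga j z (ltnW jn) zs.
  have gjp : 0 < cmod (g (a j * z)) by rewrite cmod_gt0.
  have [|eL hL] := HL (g (a j.+1 * z) / g (a j * z)).
    have -> : g (a j.+1 * z) / g (a j * z) - 1 = (g (a j.+1 * z) - g (a j * z)) / g (a j * z).
      by rewrite mulrBl divff.
    rewrite cmodM cmodV ltr_pdivrMr//.
    have rs y : cmod y < s -> cmod y < rho by move=> /lt_trans; apply.
    apply: (le_lt_trans (HB _ _ (rs _ (aS j z (ltnW jn) zs)) (rs _ (aS j.+1 z jn zs)))).
    have -> : a j.+1 * z - a j * z = (n%:R^-1)%:C * z.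
      rewrite -mulrBl /a -rmorphB; congr (_%:C * _).
      by rewrite -mulrBl -natrB ?subSnn ?mul1r.
    rewrite cmodM cmod_real gtr0_norm ?invr_gt0//.
    apply: (@lt_le_trans _ _ (eta * m)); last first.
      by rewrite ler_wpM2l ?(ltW eta0)//; apply: Hc; apply: ltW; exact: aS (ltnW jn) zs.
    have : B * (n%:R^-1 * cmod z) <= B * s / n%:R.
      by rewrite mulrA mulrAC ler_wpM2r ?invr_ge0 ?ler0n// ler_wpM2l ?ltW.
    move=> /le_lt_trans; apply; rewrite ltr_pdivrMr//.
    by move: nB; rewrite !ltr_pdivrMr//; lra.
  split; last by rewrite cexpD ez eL mulrC divfK.
  apply: holoD; first exact: hz.
  apply: (@holo_comp _ L (fun w => g (a j.+1 * w) / g (a j * w))); first exact: hL.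
  exact: (@holo_div _ (fun w => g (a j.+1 * w)) (fun w => g (a j * w)) z
    (gah j.+1 z) (gah j z) gj).
have [h Hh] := H n (leqnn n); exists h => z zs; have [hz ->] := Hh z zs.
by rewrite /a divff ?gt_eqF// rmorph1 mul1r.
Qed.

(** Landau's argument: at a point [z0] where [cmod (der h z) * (tau - cmod z)] is at
    least half of its supremum [S], the derivative is nearly constant on a
    disc of radius comparable to [tau - cmod z0], so the image contains a disc
    of radius [S / 2048]. If no disc of radius 4 is covered, then [S] is at
    most [4 * 64 * 32 = 4 * 2048]. *)
Theorem bloch_landau h s (K : R) : 4 * 64 * 32 <= K -> 0 < s ->
  (forall z, cmod z < s -> holo h z) ->
  (forall z0, cmod z0 < s ->
     ~ forall w, cmod (w - h z0) < 4 -> exists2 z, cmod z < s & h z = w) ->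
  forall z, cmod z < s / 4 -> cmod (h z - h 0) <= K.
Proof.
move=> hK s0 hh nodisc.
have [M HM] : exists M, forall z, cmod z <= s * 3 / 4 -> cmod (h z) <= M.
  by apply: bounded_on_disc => z zs; apply: holo_cont_at; apply: hh; lra.
have hd z : cmod z < s / 2 -> cmod (der h z) <= 2 * M / (s / 8).
  move=> zs; apply: (@der_bounded _ h 0 (s * 3 / 4)); rewrite ?subr0; try lra.
  - by move=> y; rewrite subr0 => ys; apply: hh; lra.
  - by move=> y; rewrite subr0 => ys; apply: HM; lra.
set tau := s / 2 in hd *; have tau0 : 0 < tau by rewrite /tau; lra.
have taus : tau < s by rewrite /tau; lra.
pose N z := cmod (der h z) * (tau - cmod z).
pose E := [set N z | z in [set z | cmod z < tau]].
have EN z : cmod z < tau -> E (N z) by move=> zt; exists z.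
have E0 : E !=set0 by exists (N 0), 0 => //; suff : cmod (0 : C) < tau by []; rewrite cmod0.
have EU : has_ubound E.
  exists (2 * M / (s / 8) * tau) => _ [z /= zt <-].
  by apply: ler_pM; rewrite ?cmod_ge0 ?subr_ge0 ?(ltW zt)// ?hd// gerBl cmod_ge0.
set S := sup E.
have NS z : cmod z < tau -> N z <= S by move=> zt; apply: ub_le_sup => //; exact: EN.
have S8 : S <= K.
  rewrite leNgt; apply/negP => S8.
  (* [z0] nearly maximizes [N]. *)
  have S2 : 0 < S / 2 by lra.
  have [_ [z0 /= z0t <-] NS0] := @sup_adherent _ E (S / 2) S2 (conj E0 EU).
  have {}NS0 : S / 2 < N z0 by move: NS0; rewrite -/S; lra.
  set t := (tau - cmod z0) / 2; have t0 : 0 < t by rewrite /t; lra.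
  set c := cmod (der h z0).
  have Nc : N z0 = 2 * (c * t) by rewrite /N /t /c; lra.
  have cp : 0 < c.
    rewrite lt_def cmod_ge0 andbT; apply/eqP => c0.
    by move: NS0; rewrite Nc c0 mul0r mulr0; lra.
  have ball z : cmod (z - z0) < t -> cmod z < tau /\ t <= tau - cmod z.
    by move=> zt; have := cmodD (z - z0) z0; rewrite subrK; move: zt; rewrite /t; lra.
  have B z : cmod (z - z0) < t -> holo h z /\ cmod (der h z) <= 4 * c.
    move=> /ball[zt zt2]; split; first by apply: hh; lra.
    have := NS z zt; rewrite /N => A.
    have : cmod (der h z) * t <= S by apply: le_trans A; rewrite ler_wpM2l ?cmod_ge0.
    move=> At; rewrite -(ler_pM2r t0); apply: (le_trans At).
    by rewrite -mulrA; move: NS0; rewrite Nc; move: (c * t) => u; lra.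
  have lip := der_lipschitz t0 B.
  have t64 : 0 < t / 64 by lra.
  have near z : cmod (z - z0) < t / 64 ->
      holo h z /\ cmod (der h z - der h z0) <= cmod (der h z0) / 2.
    move=> zt; split; first by apply: (B z _).1; lra.
    apply: le_trans (lip z _) _; first lra.
    have -> : cmod (der h z0) / 2 = 8 * (4 * c) / t * (t / 64).
      by rewrite -/c; field; rewrite gt_eqF.
    by apply: ler_wpM2l; [apply: divr_ge0; lra|exact: ltW].
  have d0 : der h z0 != 0 by rewrite -cmod_gt0.
  apply: (nodisc z0); first lra.
  move=> w w4; have [|z zt zw] := covering t64 d0 near (w := w).
    apply: (lt_le_trans w4); rewrite -/c.
    have -> : c * (t / 64) / 8 = c * t / 512 by field.
    by move: NS0; rewrite Nc; move: (c * t) => u; lra.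
  exists z => //; have [zt' _] : cmod z < tau /\ t <= tau - cmod z by apply: ball; lra.
  exact: lt_trans taus.
have H z : cmod (z - 0) < s / 4 -> holo h z /\ cmod (der h z) <= K / (s / 4).
  rewrite subr0 => zs; split; first by apply: hh; lra.
  rewrite ler_pdivlMr; last lra.
  have zt : cmod z < tau by rewrite /tau; lra.
  apply: le_trans S8; apply: le_trans (NS z zt); rewrite /N.
  by rewrite ler_wpM2l ?cmod_ge0// /tau; lra.
move=> z zs.
have s4 : 0 < s / 4 by rewrite divr_gt0.
have Z0 : cmod (0 - 0 : C) < s / 4 by rewrite subr0 cmod0.
have Zz : cmod (z - 0) < s / 4 by rewrite subr0.
apply: (le_trans (mean_value_ball H Z0 Zz)); rewrite subr0.
have K0 : 0 <= K by apply: le_trans hK; rewrite !mulr_ge0.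
by rewrite mulrAC ler_pdivrMr// ler_wpM2l// ltW.
Qed.

Definition unbounded (A : set C^o) := forall M : R, exists2 z, A z & M < cmod z.

(** The distances to [a] form an interval that contains 0 and is unbounded. *)
Lemma connected_meets_circle (A : set C^o) (a : C) (t : R) : connected A -> A a ->
  0 <= t -> unbounded A ->
  exists2 w, A w & cmod (w - a) = t.
Proof.
move=> cA Aa t0 uA.
have cont (z : C) : A z -> cont_at (fun w => w - a) z.
  move=> _; apply: holo_cont_at; apply: holoB; last exact: holo_cst.
  exact: cder_holo (cder_id z).
have /connected_intervalP I := connected_continuous_connected cA (continuous_cmod_within cont).
have [z Az zM] := uA (t + cmod a).
have : ((fun z : C^o => cmod (z - a)) @` A) t.
  apply: (I 0 (cmod (z - a))).
  - by exists a => //; rewrite subrr cmod0.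
  - by exists z.
  - by rewrite t0 /=; have := cmodD (z - a) a; rewrite subrK; lra.
by case=> w Aw wt; exists w.
Qed.

(** Suppose that [A] meets the disc of radius [2 * rho] at [a]. A logarithm of
    [f - a] covers no disc of radius 4: otherwise [f] would take every value on
    some circle about [a], and [A] crosses all of these. By the Bloch-Landau
    theorem [f] is then [O(rho)] on a smaller disc; if this happens for
    arbitrarily large [rho], [f] is affine. *)
Theorem missed_set_far f : (forall z, holo f z) ->
  ~ (exists a b, forall z, f z = a + b * z) ->
  exists2 rho0 : R, 0 < rho0 & forall (rho : R) (A : set C^o) (a : C), rho0 <= rho ->
    connected A -> unbounded A -> A a ->
    (forall z, cmod z < rho -> ~ A (f z)) -> 2 * rho <= cmod a.
Proof.
move=> fh fna; apply: contrapT => H.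
have [K hK] : exists K : R, 4 * 64 * 32 <= K by exists (4 * 64 * 32).
pose E : R := expR K; have E0 : 0 <= E by exact: expR_ge0.
apply: fna; exists (f 0), (der f 0).
apply: (@entire_affine _ f (8 * (2 + (cmod (f 0) + 2) * E))) => // r0.
have [rho [A [a [rr [cA uA] Aa Af a2]]]] : exists rho (A : set C^o) (a : C),
   [/\ Num.max 1 (8 * r0) <= rho, connected A /\ unbounded A, A a,
    (forall z, cmod z < rho -> ~ A (f z)) & cmod a < 2 * rho].
  apply: contrapT => H'; apply: H; exists (Num.max 1 (8 * r0)).
    by rewrite lt_max ltr01.
  move=> rho A a rr cA uA Aa Af; rewrite leNgt; apply/negP => a2.
  by apply: H'; exists rho, A, a.
move: rr; rewrite ge_max => /andP[rho1 rhor].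
have fa z : cmod z < rho -> f z - a != 0.
  by move=> zr; rewrite subr_eq0; apply/eqP => E'; apply: (Af z zr); rewrite E'.
have gh z : holo (fun w => f w - a) z.
  by apply: holoB; [exact: fh|exact: holo_cst].
have [||h Hh] := @log_branch (fun z => f z - a) rho (rho / 2) _ _ gh fa; [lra|lra|].
have bl : forall z, cmod z < rho / 2 / 4 -> cmod (h z - h 0) <= K.
  apply: (bloch_landau hK); [lra|by move=> z /Hh[]|].
  (* A covered disc of radius 4 > pi about [h z0] contains a logarithm of
     [w - a] for the point [w] of [A] with [cmod (w - a) = cmod (f z0 - a)]. *)
  move=> z0 zr disc.
  have [_ e0] := Hh z0 zr.
  have c0 : f z0 - a != 0 by apply: fa; lra.
  have cp : 0 < cmod (f z0 - a) by rewrite cmod_gt0.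
  have [w Aw wt] := connected_meets_circle cA Aa (ltW cp) uA.
  have wa : w - a != 0 by rewrite -cmod_gt0 wt.
  have [|y ey Iy] := @cexp_polar _ ((w - a) / (f z0 - a)).
    by rewrite mulf_neq0// invr_eq0.
  have Ry : complex.Re y = 0.
    by apply: expR_inj; rewrite -cmod_cexp ey cmodM cmodV wt divff ?gt_eqF// expR0.
  have [|z zr' hz] := disc (h z0 + y).
    rewrite addrAC subrr add0r; apply: (le_lt_trans (cmod_le_ReIm _)).
    rewrite Ry normr0 add0r; apply: (le_lt_trans Iy).
    by have := @pihalf_lt2 R; lra.
  have [_ ez] := Hh z zr'.
  apply: (Af z); first lra.
  suff -> : f z = w by [].
  apply: (addIr (- a)); rewrite -ez hz cexpD e0 ey.
  by rewrite mulrC divfK.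
exists (rho / 8); first lra.
move=> z zr.
have zr2 : cmod z < rho / 2 by lra.
have zr8 : cmod z < rho / 2 / 4 by lra.
have r2 : cmod (0 : C) < rho / 2 by rewrite cmod0; lra.
have [_ ez] := Hh z zr2; have [_ e0] := Hh 0 r2.
have fz : cmod (f z - a) <= cmod (f 0 - a) * E.
  rewrite -ez -e0 -[h z](subrK (h 0)) addrC cexpD cmodM ler_wpM2l ?cmod_ge0//.
  rewrite cmod_cexp ler_expR; apply: le_trans (bl z zr8).
  by apply: le_trans (Re_le_cmod _); exact: ler_norm.
have -> : 8 * (2 + (cmod (f 0) + 2) * E) * (rho / 8) = 2 * rho + (cmod (f 0) * rho + 2 * rho) * E.
  by field.
have A1 := cmodD (f z - a) a; rewrite subrK in A1.
have A2 := cmodBD (f 0) a.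
have A3 : cmod (f 0 - a) * E <= (cmod (f 0) * rho + 2 * rho) * E.
  rewrite ler_wpM2r//; apply: (le_trans A2); apply: lerD; last lra.
  by rewrite ler_peMr ?cmod_ge0.
lra.
Qed.
End LargeCovering.

(** * Hulls *)

Section Hull.
Context {R : realType}.
Local Notation C := R[i].
Implicit Types (z w : C) (e d r s t : R) (U V : set C^o).

Definition disc r : set C^o := [set z | cmod z < r].

Lemma open_disc r : open (disc r).
Proof.
apply/openC => z zr; exists (r - cmod z); first by rewrite subr_gt0.
by move=> y yz; rewrite /disc/=; have := cmodD (y - z) z; rewrite subrK; lra.
Qed.

Definition outer U : set C^o := [set z |
  exists A : set C^o, [/\ connected A, unbounded A, A z & forall x, A x -> ~ U x]].

(** [U] with its holes filled. Removing the closure of the outer points makes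
    the hull open by construction. *)
Definition hull U : set C^o := ~` closure (outer U).

Lemma open_hull U : open (hull U).
Proof. exact/closed_openC/closed_closure. Qed.

Lemma sub_hull U : open U -> U `<=` hull U.
Proof.
move=> /openC oU z /oU[e e0 eU] /closureC/(_ _ e0)[y [A [_ _ Ay AU]] yz].
exact: AU Ay (eU _ yz).
Qed.

Lemma hull_mono U V : U `<=` V -> hull U `<=` hull V.
Proof.
move=> UV; apply: subsetC; apply: closureS => z [A [cA uA Az AV]].
by exists A; split=> // x /AV Vx /UV.
Qed.

Lemma continuous_line (z v : C) :
  continuous (fun t : R^o => (z + t%:C * v) : C^o).
Proof.
move=> t; have P := @cvgC R _ (nbhs (t : R^o)) _ (fun t : R^o => z + t%:C * v)
  (z + t%:C * v); apply/P => e e0.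
have v1 : 0 < cmod v + 1 by rewrite ltr_wpDl ?cmod_ge0.
exists (e / (cmod v + 1)); first by rewrite /= divr_gt0.
move=> s /=; rewrite distrC ltr_pdivlMr// => st.
rewrite opprD addrACA subrr add0r -mulrBl -rmorphB cmodM cmod_real.
by apply: le_lt_trans st; rewrite ler_wpM2l// lerDl.
Qed.

Lemma connected_line (z v : C) (I : interval R) :
  connected ((fun t : R^o => (z + t%:C * v) : C^o) @` [set` I]).
Proof.
apply: connected_continuous_connected; first exact/connected_intervalP/interval_is_interval.
by apply: continuous_subspaceT; exact: continuous_line.
Qed.

Definition frontier U : set C^o := [set z | closure U z /\ ~ U z].

(** A frontier point of the hull away from [U] has a ball missing [U] that meets
    both the hull and an outer point; a segment in this ball would make a
    point of the hull outer. *)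
Lemma frontier_hull U : open U -> frontier (hull U) `<=` frontier U.
Proof.
move=> oU w [cw hw].
have wU : ~ U w by move=> /(sub_hull oU).
split=> //; apply: contrapT => ncU.
have /openC/(_ w ncU)[e e0 eU] : open (~` closure U) by exact/closed_openC/closed_closure.
have {}eU y : cmod (y - w) < e -> ~ U y by move=> /eU nU /subset_closure.
have e20 : 0 < e / 2 by rewrite divr_gt0.
have /closureC/(_ _ e20)[x [A [cA uA Ax AU]] xw] : closure (outer U) w by apply: contrapT.
have /closureC/(_ _ e20)[y hy yw] := cw.
apply: hy; apply: subset_closure.
(* The segment from [x] to [y] stays in a ball that misses [U]. *)
pose L := (fun t : R^o => (x + t%:C * (y - x)) : C^o) @` `[0, 1].
have L0 : L x by exists 0; rewrite ?rmorph0 ?mul0r ?addr0//= in_itv/= lexx ler01.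
have L1 : L y.
  exists 1; first by rewrite /= in_itv/= lexx ler01.
  by rewrite rmorph1 mul1r addrC subrK.
exists (A `|` L); split.
- apply: connectedU => //; last exact: connected_line.
  by exists x.
- by move=> M; have [z Az Mz] := uA M; exists z => //; left.
- by right.
- move=> x' [/AU//|[t /= +] tx']; rewrite in_itv/= => /andP[t0 t1]; apply: eU.
  rewrite -tx'.
  have -> : x + t%:C * (y - x) - w = (1 - t)%:C * (x - w) + t%:C * (y - w).
    by rewrite rmorphB/= rmorph1; ring.
  apply: (le_lt_trans (cmodD _ _)); rewrite !cmodM !cmod_real !ger0_norm ?subr_ge0//.
  have := cmod_ge0 (x - w); have := cmod_ge0 (y - w); nra.
Qed.

(** The ray from [w] away from the origin misses [disc M]. *)
Lemma hull_bounded U (M : R) : 0 < M -> U `<=` disc M -> hull U `<=` disc M.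
Proof.
move=> M0 UM w hw; rewrite /disc/= ltNge; apply/negP => Mw; apply: hw.
apply: subset_closure.
have wp : 0 < cmod w by lra.
exists ((fun t : R^o => (0 + t%:C * w) : C^o) @` `[1, +oo[); split.
- exact: connected_line.
- move=> K; set t := 1 + `|K| / cmod w.
  have t1 : 1 <= t by rewrite lerDl divr_ge0// ltW.
  exists (0 + t%:C * w); first by exists t => //; rewrite /= in_itv/= t1.
  rewrite add0r cmodM cmod_real ger0_norm; last lra.
  rewrite /t mulrDl mul1r divfK ?gt_eqF//; have := ler_norm K; lra.
- by exists 1; rewrite ?rmorph1 ?mul1r ?add0r//= in_itv/= lexx.
- move=> _ [t /= + <-]; rewrite in_itv/= andbT => t1 /UM; rewrite /disc/= add0r cmodM cmod_real.
  rewrite ger0_norm; last lra.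
  nra.
Qed.

Lemma closure_hull U V : open U -> open V -> closure U `<=` V ->
  closure (hull U) `<=` hull V.
Proof.
move=> oU oV UV w cw; have [hw|hw] := pselect (hull U w).
  by move: hw; apply: hull_mono; apply: subset_trans UV; exact: subset_closure.
have [cU _] := frontier_hull oU (conj cw hw).
exact: sub_hull (UV _ cU).
Qed.

Lemma closure_bounded U M : U `<=` disc M -> forall z, closure U z -> cmod z <= M.
Proof.
move=> UM z /closureC cz; apply/ler_addgt0Pr => e /cz[y /UM yM yz].
have := cmodD (z - y) y; rewrite subrK cmodB; move: yM; rewrite /disc/=; lra.
Qed.

Lemma compact_closure_bounded U M : U `<=` disc M -> compact (closure U).
Proof.
move=> UM; apply: (@compact_closed_bounded _ _ M); first exact: closed_closure.
exact: closure_bounded.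
Qed.

Lemma closure_image (f : C -> C) U M : (forall z, cont_at f z) -> U `<=` disc M ->
  closure (f @` U : set C^o) `<=` f @` closure U.
Proof.
move=> fc UM.
have cl : closed (f @` closure U : set C^o).
  apply: compact_closed; first exact: norm_hausdorff.
  apply: continuous_compact (compact_closure_bounded UM).
  by apply: continuous_subspaceT => z; apply/continuousC; exact: fc.
apply: subset_trans cl; apply: closureS; apply: image_subset.
exact: subset_closure.
Qed.

(** Leave [U] along the positive real axis. *)
Lemma frontier_nonempty U M : open U -> U `<=` disc M -> U 0 -> frontier U !=set0.
Proof.
move=> oU UM U0.
pose E := [set x : R | 0 <= x /\ U x%:C].
have E0 : E !=set0 by exists 0; split.
have EU x : E x -> x <= M.
  move=> [x0 /UM xM]; have : cmod x%:C < M by [].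
  by rewrite cmod_real ger0_norm// => /ltW.
have Es : has_sup E by split=> //; exists M.
have s0 : 0 <= sup E by apply: ub_le_sup; [exact: Es.2|split].
exists (sup E)%:C; split.
  apply/closureC => e e0; have [x Ex xs] := sup_adherent e0 Es.
  exists x%:C; first exact: Ex.2.
  rewrite -rmorphB cmod_real distrC ger0_norm ?subr_ge0; first lra.
  by apply: ub_le_sup => //; exact: Es.2.
move=> Us; have [e e0 eU] := (openC _).1 oU _ Us.
have : E (sup E + e / 2).
  split; first lra.
  by apply: eU; rewrite -rmorphB cmod_real addrAC subrr add0r gtr0_norm; lra.
by move=> /(ub_le_sup Es.2); lra.
Qed.
End Hull.

(** * The growing images of a disc *)

Section Domains.
Context {R : realType} (f : R[i] -> R[i]).
Context (fh : forall z, holo f z).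
Context (fna : ~ (exists a b, forall z, f z = a + b * z)).
Local Notation C := R[i].
Implicit Types (z w : C) (e d r s t : R) (U V : set C^o).

(** Filling after each application of [f] makes the sets contain large discs,
    while their frontiers still lie in the image of the previous frontier. *)
Fixpoint grown t n : set C^o :=
  if n is m.+1 then hull (f @` grown t m) else disc t.

Let fc z : cont_at f z. Proof. exact: holo_cont_at (fh z). Qed.

Let fnc : ~ exists a, forall z, f z = a.
Proof. by move=> [a fa]; apply: fna; exists a, 0 => z; rewrite mul0r addr0. Qed.

Lemma open_grown t n : open (grown t n).
Proof. by case: n => [|n]; [exact: open_disc|exact: open_hull]. Qed.

Lemma open_image_grown t n : open (f @` grown t n : set C^o).
Proof. exact: (@open_mapping _ f fh fnc (grown t n) (@open_grown t n)). Qed.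

Lemma bounded_grown t n : exists2 M : R, 0 < M & grown t n `<=` disc M.
Proof.
elim: n => [|n [M M0 HM]].
  exists (`|t| + 1) => [|z]; first by rewrite ltr_wpDl.
  by rewrite /= /disc/=; have := ler_norm t; lra.
have [B HB] := @bounded_on_disc _ f M (fun z _ => fc z).
have B1 : 0 < `|B| + 1 by rewrite ltr_wpDl.
exists (`|B| + 1) => //; apply: hull_bounded => // _ [z /HM/ltW/HB zB <-].
by rewrite /disc/=; have := ler_norm B; lra.
Qed.

Lemma grown_mono s t n : s <= t -> grown s n `<=` grown t n.
Proof.
move=> st; elim: n => [z|n IH] /=; first by move=> /lt_le_trans; apply.
by apply: hull_mono; apply: image_subset.
Qed.

(** Strictness in [t] passes through [f] because the closure of a bounded set
    has compact image, and through the hull. *)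
Lemma grown_strict s t n : s < t -> closure (grown s n) `<=` grown t n.
Proof.
move=> st; elim: n => [z|n IH] /=.
  by move=> /(closure_bounded (@subset_refl _ (disc s))) zs; rewrite /disc/=; lra.
apply: closure_hull; [exact: open_image_grown|exact: open_image_grown|].
have [M _ HM] := bounded_grown s n.
by apply: subset_trans (closure_image fc HM) _; exact: image_subset.
Qed.

(** Since [f] is open, a frontier point of the image cannot come from an
    interior point. *)
Lemma frontier_grown_step t n : frontier (grown t n.+1) `<=` f @` frontier (grown t n).
Proof.
move=> w /(frontier_hull (@open_image_grown t n))[cw nw].
have [M _ HM] := bounded_grown t n.
have [z cz zw] := closure_image fc HM cw.
by exists z => //; split=> // Dz; apply: nw; exists z.
Qed.

Lemma grown_next r t n : disc t `<=` hull (f @` disc r) -> grown t n `<=` grown r n.+1.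
Proof.
move=> H; elim: n => [//|n IH]; rewrite [grown r n.+2]/=.
by apply: hull_mono; apply: image_subset.
Qed.

Lemma iter_cont_at n z : cont_at (iter n f) z.
Proof.
elim: n => [|n IH] e e0; first by exists e.
have [d d0 Hd] := fc (iter n f z) e0.
by have [d' d'0 Hd'] := IH _ d0; exists d' => // y /Hd'/Hd.
Qed.

(** Frontier points of [grown t n] have backward orbits along the frontiers;
    an accumulation point of their origins follows all frontiers. *)
Lemma frontier_orbit t : (forall n, grown t n 0) ->
  exists z, forall n, frontier (grown t n) (iter n f z).
Proof.
move=> D0.
have back n w : frontier (grown t n) w ->
    exists2 z, iter n f z = w & forall i, (i <= n)%N -> frontier (grown t i) (iter i f z).
  elim: n w => [|n IH] w wb.
    by exists w => // i; rewrite leqn0 => /eqP ->.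
  have [w' /IH[z zw' zi] w'w] := frontier_grown_step wb.
  exists z => [|i]; first by rewrite iterS zw'.
  rewrite leq_eqVlt => /predU1P[->|]; last by rewrite ltnS; exact: zi.
  by rewrite iterS zw' w'w.
have /choice[u Hu] : forall n, exists z : C,
    forall i, (i <= n)%N -> frontier (grown t i) (iter i f z).
  move=> n; have [M _ HM] := bounded_grown t n.
  have [w /back[z _ zi]] := frontier_nonempty (@open_grown t n) HM (D0 n).
  by exists z.
have K := @compact_disc R t.
have [|p [pt pu]] := K ((u : nat -> C^o) @ \oo) _ _.
  exists 0%N => // n _ /=; have [+ _] := Hu n 0%N isT.
  exact: (closure_bounded (@subset_refl _ (disc t))).
exists p => n.
have near d : 0 < d -> exists2 z, frontier (grown t n) (iter n f z) & cmod (z - p) < d.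
  move=> d0.
  have [||z [[m lenm <-] zd]] := pu (u @` [set m | (n <= m)%N]) [set z | cmod (z - p) < d].
  - by exists n => // m lenm /=; exists m.
  - by apply/nbhsC; exists d.
  by exists (u m) => //; exact: Hu.
apply: contrapT => nb.
have /openC/(_ _ nb)[e e0 He] : open (~` frontier (grown t n)).
  apply/closed_openC; apply: closedI; first exact: closed_closure.
  exact/open_closedC/open_grown.
have [d d0 Hd] := iter_cont_at n p e0.
by have [z zb /Hd/He] := near d d0.
Qed.

Lemma disc_sub_hull (rho0 : R) :
  (forall (rho : R) (A : set C^o) (a : C), rho0 <= rho ->
    connected A -> unbounded A -> A a ->
    (forall z, cmod z < rho -> ~ A (f z)) -> 2 * rho <= cmod a) ->
  forall rho, rho0 <= rho -> disc (2 * rho) `<=` hull (f @` disc rho).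
Proof.
move=> H rho rr w w2; have [//|nw] := pselect (hull (f @` disc rho) w).
have [e e0 He] := (openC _).1 (@open_disc _ (2 * rho)) _ w2.
have /closureC/(_ _ e0)[a [A [cA uA Aa AU]] aw] :
  closure (outer (f @` disc rho)) w by apply: contrapT.
have : cmod a < 2 * rho by exact: He.
rewrite ltNge (H rho A a)// => z zr Az.
by apply: (AU _ Az); exists z.
Qed.

Lemma disc_sub_grown (rho0 : R) : 0 < rho0 ->
  (forall rho, rho0 <= rho -> disc (2 * rho) `<=` hull (f @` disc rho)) ->
  forall n, disc (2 ^+ n * rho0) `<=` grown rho0 n.
Proof.
move=> r0 H; elim=> [|n IH]; first by rewrite expr0 mul1r.
rewrite exprS -mulrA; apply: (subset_trans (H _ _)).
  by rewrite ler_peMl ?(ltW r0)// exprn_ege1// ler1n.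
by apply: hull_mono; exact: image_subset.
Qed.
End Domains.

(** * Entropy carried by escaping layers *)

Section LayeredEntropy.
Context {R : realType} {X : topologicalType} (f : X -> X) (G : R -> nat -> set X).
Implicit Types (x y s : R) (p : X) (n m : nat) (A : set X).
Context (oG : forall x n, open (G x n))
  (sG : forall x y n, x < y -> closure (G x n) `<=` G y n)
  (nG : forall n, closure (G 1 n) `<=` G 0 n.+1)
  (eG : forall p, exists n, G 0 n p)
  (Z : R -> X)
  (ZG : forall x n, 0 <= x <= 1 -> closure (G x n) (iter n f (Z x)) /\
                                   ~ G x n (iter n f (Z x))).

Lemma layer_mono x y n : x <= y -> G x n `<=` G y n.
Proof.
rewrite le_eqVlt => /predU1P[->//|xy] p Gp.
by apply: (sG xy); exact: subset_closure.
Qed.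

(** Between consecutive times the sets increase past all parameters in
    [[0, 1]], so layers of different times are disjoint. *)
Lemma layer_next x y n m : x <= 1 -> 0 <= y -> (n < m)%N ->
  closure (G x n) `<=` G y m.
Proof.
move=> x1 y0 ltnm p cp.
suff : G 0 m p by exact: layer_mono.
have {}cp : G 0 n.+1 p by apply: nG; apply: closureS cp; exact: layer_mono.
elim: m ltnm => [//|m IH]; rewrite ltnS leq_eqVlt => /predU1P[<-//|/IH Gm].
by apply: nG; apply: subset_closure; apply: layer_mono Gm; exact: ler01.
Qed.

Context (N : nat) (N0 : (0 < N)%N).

Definition node n m : R := m%:R / N%:R ^+ n.

Lemma Nn_gt0 n : 0 < (N%:R : R) ^+ n.
Proof. by rewrite exprn_gt0// ltr0n. Qed.

Lemma node_lt n m m' : (m < m')%N -> node n m < node n m'.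
Proof. by move=> mm; rewrite ltr_pM2r ?invr_gt0 ?Nn_gt0// ltr_nat. Qed.

Lemma node01 n m : (m <= N ^ n)%N -> 0 <= node n m <= 1.
Proof.
move=> mN; rewrite /node divr_ge0 ?ler0n ?(ltW (Nn_gt0 n))//=.
by rewrite ler_pdivrMr ?Nn_gt0// mul1r -natrX ler_nat.
Qed.

(** The [N ^ n] layers at time [n] are indexed by the [N]-adic intervals of
    length [N ^ - n] of the parameter. *)
Definition layer n m : set X := closure (G (node n m.+1) n) `\` G (node n m) n.

Lemma closed_layer n m : closed (layer n m).
Proof.
apply: closedI; first exact: closed_closure.
exact/open_closedC/oG.
Qed.

Lemma layer_disjoint n m n' m' p : (m < N ^ n)%N -> (m' < N ^ n')%N ->
  layer n m p -> layer n' m' p -> n = n' /\ (m' <= m.+1)%N.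
Proof.
move=> mN mN' [c1 g1] [c2 g2].
have [/andP[_ h1] /andP[h2 _]] := (node01 mN, node01 (ltnW mN)).
have [/andP[_ h1'] /andP[h2' _]] := (node01 mN', node01 (ltnW mN')).
have [nn|nn|nn] := ltngtP n n'.
- by exfalso; apply: g2; apply: (layer_next h1 h2' nn).
- by exfalso; apply: g1; apply: (layer_next h1' h2 nn).
subst n'; split=> //; rewrite leqNgt; apply/negP => mm.
by apply: g2; apply: (sG (node_lt n mm)).
Qed.

Definition address n x : nat := Num.truncn (x * N%:R ^+ n).

Lemma addressP n x : 0 <= x < 1 ->
  [/\ (address n x < N ^ n)%N, node n (address n x) <= x & x < node n (address n x).+1].
Proof.
move=> /andP[x0 x1].
have xN : 0 <= x * N%:R ^+ n by rewrite mulr_ge0// ltW ?Nn_gt0.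
have /andP[h1 h2] := truncn_itv xN.
rewrite -/(address n x) in h1 h2.
split; last by rewrite ltr_pdivlMr ?Nn_gt0.
  rewrite -(ltr_nat R) natrX; apply: (le_lt_trans h1).
  by rewrite gtr_pMl ?Nn_gt0.
by rewrite ler_pdivrMr ?Nn_gt0.
Qed.

Lemma orbit_layer n x : 0 <= x < 1 -> layer n (address n x) (iter n f (Z x)).
Proof.
move=> x01; have [aN a1 a2] := addressP n x01.
have [|c g] := @ZG x n; first by case/andP: x01 => -> /ltW ->.
split; first by apply: subset_closure; exact: (sG a2).
by move=> /(layer_mono a1).
Qed.

Let K := (4 * N)%N.

Lemma K_gt0 : (0 < K)%N. Proof. by rewrite muln_gt0. Qed.

(** Adjacent layers share a frontier, so a member of the cover has to accept two
    consecutive colors. *)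
Definition color_ok (j m : nat) := (m == j %[mod K]) || (m == j.+1 %[mod K]).

(** A point of no layer belongs to all cells; this makes the cells cover the
    whole space. *)
Definition cell (j : nat) : set X :=
  [set p | forall n m, (m < N ^ n)%N -> layer n m p -> color_ok j m].

(** Each point has a neighbourhood [G 0 n0] that meets layers of finitely many
    times only. *)
Lemma open_cell j : open (cell j).
Proof.
rewrite openE => p Ep; have [n0 Gp] := eG p.
pose B n := \bigcup_(m in [set m | (m < N ^ n)%N /\ ~~ color_ok j m]) layer n m.
have cB : closed (\bigcup_(n in `I_n0) B n).
  apply: closed_bigcup => [|n _]; first exact: finite_II.
  apply: closed_bigcup => [|m _]; last exact: closed_layer.
  by apply: (sub_finite_set _ (finite_II (N ^ n))) => m [].
(* Near [p] only the layers of the finitely many times [n < n0] matter. *)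
have nb : nbhs p (G 0 n0 `&` ~` (\bigcup_(n in `I_n0) B n)).
  apply: open_nbhs_nbhs; split; first exact: openI (oG _ _) (closed_openC cB).
  by split=> // -[n _ [m [mN mj] /(Ep n m mN)]]; exact/negP.
apply: filterS nb => q [Gq nBq] n m mN Lq.
apply: contrapT => /negP mj; apply: nBq.
exists n; last by exists m.
rewrite /= ltnNge; apply/negP => nn; have [_ nG'] := Lq; apply: nG'.
have /andP[m0 _] := node01 (ltnW mN).
move: nn; rewrite leq_eqVlt => /predU1P[E|nn].
  by subst n; exact: layer_mono m0 _ Gq.
by apply: (layer_next ler01 m0 nn); exact: subset_closure.
Qed.

Definition layer_cover : set (set X) := cell @` `I_K.

(** The layers through a point have a common time and, at that time, an index
    that is minimal or one more. *)
Lemma finite_open_layer_cover : finite_open_cover layer_cover.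
Proof.
split; first by apply: finite_image; exact: finite_II.
  by move=> _ [j _ <-]; exact: open_cell.
rewrite -subTset => p _.
have [[n [m [mN Lp]]]|no] := pselect (exists n m, (m < N ^ n)%N /\ layer n m p).
  have ex : exists m, (m < N ^ n)%N && `[< layer n m p >].
    by exists m; rewrite mN; apply/asboolP.
  have [m0 /andP[m0N /asboolP Lm0] mmin] := ex_minnP ex.
  exists (cell (m0 %% K)).
    by exists (m0 %% K)%N => //=; rewrite ltn_mod K_gt0.
  move=> n' m' m'N Lm'.
  have [E le1] := layer_disjoint m0N m'N Lm0 Lm'; subst n'.
  have : (m0 <= m')%N by apply: mmin; rewrite m'N; apply/asboolP.
  rewrite /color_ok -[(m0 %% K).+1]addn1 modnDml modn_mod addn1.
  by rewrite leq_eqVlt => /predU1P[->|lt1]; [rewrite eqxx|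
    have -> : m' = m0.+1 by [apply/eqP; rewrite eqn_leq le1]; rewrite eqxx orbT].
exists (cell 0); first by exists 0%N => //=; exact: K_gt0.
by move=> n m mN Lp; exfalso; apply: no; exists n, m.
Qed.

(** With [4 * N] colors, accepted indices at distance at most [2 * N] differ by
    at most 1. *)
Lemma color_close j m m' : color_ok j m -> color_ok j m' ->
  (m <= m')%N -> (m' - m <= 2 * N)%N -> (m' - m <= 1)%N.
Proof.
move=> cm cm' mm' d2; move: (subnKC mm') cm'; move: (m' - m)%N d2 => d d2 <-.
have dK : (d.+1 < K)%N by rewrite /K; lia.
have dsmall i : (i <= 1)%N -> (d == i %[mod K]) -> (d <= 1)%N.
  by move=> i1; rewrite !modn_small//; [move=> /eqP ->|lia|lia].
rewrite /color_ok in cm *.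
have mK i : (m + d == m + i %[mod K]) = (d == i %[mod K]) by rewrite eqn_modDl.
case/orP: cm => /eqP cm; case/orP.
- by rewrite -cm -{2}[m]addn0 mK; exact: dsmall.
- rewrite -[j.+1]addn1 -[((j + 1) %% K)%N]modnDml -cm modnDml mK; exact: dsmall.
- move=> H; exfalso; move: H.
  rewrite -(eqn_modDr 1) !addn1 -cm -addnS -{2}[m]addn0 eqn_modDl.
  by rewrite mod0n modn_small.
- by rewrite -cm -{2}[m]addn0 mK; exact: dsmall.
Qed.

(** Two parameters whose addresses at time [k] differ by at most 1 are at
    distance less than [2 / N ^+ k], so their addresses at time [k + 1] differ
    by at most [2 * N], and the colors reduce this again to at most 1. *)
Lemma orbit_close A k x y : 0 <= x < 1 -> 0 <= y < 1 -> A (Z x) -> A (Z y) ->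
  (forall l, (l <= k)%N -> subordinate (iter l f @` A) layer_cover) ->
  x <= y -> (address k y - address k x <= 1)%N /\ y - x < 2 / N%:R ^+ k.
Proof.
move=> x01 y01 Ax Ay; elim: k => [|k IH] H xy.
  have a0 u : 0 <= u < 1 -> address 0 u = 0%N.
    by move=> /(addressP 0)[+ _ _]; rewrite expn0 ltnS leqn0 => /eqP.
  rewrite !a0// expr0 divr1; split=> //.
  by case/andP: x01; case/andP: y01; lra.
have [_ d] := IH (fun l lk => H l (leqW lk)) xy.
have [E [j _ <-] AE] := H k.+1 (leqnn _).
have cx := AE _ (imageP _ Ax) _ _ (let: And3 a _ _ := addressP k.+1 x01 in a) (orbit_layer k.+1 x01).
have cy := AE _ (imageP _ Ay) _ _ (let: And3 a _ _ := addressP k.+1 y01 in a) (orbit_layer k.+1 y01).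
have [_ x1 x2] := addressP k.+1 x01; have [_ y1 y2] := addressP k.+1 y01.
move: x1 x2 y1 y2 cx cy; move: (address _ _) (address _ _) => m' m.
rewrite /node !ler_pdivrMr ?Nn_gt0// !ltr_pdivlMr ?Nn_gt0// => x1 x2 y1 y2 cx cy.
have P := Nn_gt0 k.+1.
have xy' : x * N%:R ^+ k.+1 <= y * N%:R ^+ k.+1 by rewrite ler_pM2r.
have mm : (m <= m')%N.
  by rewrite -ltnS -(ltr_nat R); apply: le_lt_trans y2; apply: le_trans xy'.
have dN : (y - x) * N%:R ^+ k.+1 < 2 * N%:R.
  rewrite exprS mulrCA mulrA -ltr_pdivlMr ?Nn_gt0//.
  move: d; rewrite -(ltr_pM2l (_ : 0 < N%:R :> R)) ?ltr0n// mulrA => /lt_le_trans; apply.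
  by rewrite [N%:R * 2]mulrC.
have d2 : (m' - m <= 2 * N)%N.
  rewrite -ltnS -(ltr_nat R) natrB// -natr1 natrM.
  by move: x2 dN; rewrite mulrBl -natr1; lra.
have d1 := color_close cx cy mm d2; split=> //.
rewrite mulrBl.
have : (m'%:R : R) <= m%:R + 1 by rewrite natr1 ler_nat -addn1 -leq_subLR.
by move: x1 y2; rewrite -!natr1; lra.
Qed.

Local Open Scope ereal_scope.

(** [orbit_close] solved for [k]. *)
Lemma escape_time_le A x y : (0 <= x < 1)%R -> (0 <= y < 1)%R ->
  A (Z x) -> A (Z y) -> (x < y)%R -> (1 < N)%N ->
  escape_time R f layer_cover A <= (ln (2 / (y - x)) / ln N%:R)%:E.
Proof.
move=> x01 y01 Ax Ay xy N1.
have lN : (0 < ln (N%:R : R))%R by rewrite ln_gt0// ltr1n.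
have yx : (0 < y - x)%R by rewrite subr_gt0.
have yx1 : (y - x <= 1)%R by case/andP: x01; case/andP: y01; lra.
rewrite /escape_time; case: asboolP => [_|_]; last first.
  rewrite lee_fin divr_ge0 ?(ltW lN)// ln_ge0// ler_pdivlMr//; lra.
apply: ge_ereal_sup => _ [k Hk <-]; rewrite lee_fin ler_pdivlMr// [(k%:R * _)%R]mulr_natl -lnXn.
  have [_ d] := orbit_close x01 y01 Ax Ay Hk (ltW xy).
  rewrite ler_ln ?posrE ?Nn_gt0 ?divr_gt0// ler_pdivlMr//.
  by move: d; rewrite ltr_pdivlMr ?Nn_gt0// mulrC => /ltW.
by rewrite ltr0n.
Qed.

(** The parameters of the orbits that start in [A] lie within
    [2 * expR (- tau * ln N)] of each other, where [tau] is the escape time;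
    for [s <= ln N] this is at most twice the [s]-th power of the diameter. *)
Lemma trace_measure A s : (1 < N)%N -> (0 < s)%R -> (s <= ln N%:R)%R ->
  exists I : set R, [/\ measurable I,
    (forall x, (0 <= x < 1)%R -> A (Z x) -> I x) &
    lebesgue_measure I <= 4%:E * bowen_diam R f layer_cover A `^ s].
Proof.
move=> N1 s0 sN.
pose T := [set x | (0 <= x < 1)%R /\ A (Z x)].
have [[x0 [y0 [[x01 Ax] [y01 Ay] xy]]]|one] :=
    pselect (exists x y, [/\ T x, T y & (x < y)%R]); last first.
  have [[x0 Tx0]|no] := pselect (T !=set0); last first.
    exists set0; split => // [x x01 Ax|]; first by apply: no; exists x.
    by rewrite measure0 mule_ge0// poweR_ge0.
  exists [set x0]; split => // [x x01 Ax|]; last first.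
    by rewrite lebesgue_measure_set1 mule_ge0// poweR_ge0.
  have Tx : T x by [].
  have [xx|xx|//] := ltgtP x x0; exfalso; apply: one.
  - by exists x, x0.
  - by exists x0, x.
have lN : (0 < ln (N%:R : R))%R by rewrite ln_gt0// ltr1n.
have := escape_time_le x01 y01 Ax Ay xy N1.
have H (x y : R) := @escape_time_le A x y.
rewrite /bowen_diam; move: (escape_time R f layer_cover A) H => [tau H _|_|_ _]; last first.
- exists setT; split => //=.
  by rewrite gt_eqF// mulry gtr0_sg// mul1e leey.
- by rewrite leye_eq.
(* [delta] is twice the [s]-th power of the Bowen diameter of [A]. *)
pose delta := (2 * expR (- tau * s))%R.
have delta0 : (0 < delta)%R by rewrite mulr_gt0// expR_gt0.
exists `[(x0 - delta)%R, (x0 + delta)%R]%classic; split => //; last first.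
  rewrite lebesgue_measure_itv/= lte_fin ifT; last lra.
  by rewrite -expRM -EFinB -EFinM lee_fin /delta; lra.
have D x y : (0 <= x < 1)%R -> (0 <= y < 1)%R -> A (Z x) -> A (Z y) -> (x < y)%R ->
    (y - x <= delta)%R.
  move=> hx hy Ax' Ay' xy'; have := H _ _ hx hy Ax' Ay' xy' N1.
  have yx : (0 < y - x)%R by rewrite subr_gt0.
  have yx1 : (y - x <= 1)%R by case/andP: hx; case/andP: hy; lra.
  rewrite lee_fin ler_pdivlMr// => tl.
  have l0 : (0 <= ln (2 / (y - x)))%R by rewrite ln_ge0// ler_pdivlMr//; lra.
  have : (tau * s <= ln (2 / (y - x)))%R.
    have [t0|t0] := leP 0%R tau; last by apply: le_trans l0; nra.
    by apply: le_trans tl; rewrite ler_wpM2l.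
  rewrite -ler_expR lnK ?posrE ?divr_gt0// ler_pdivlMr// /delta mulNr expRN.
  by rewrite ler_pdivlMr ?expR_gt0// mulrC.
move=> x x01' Ax' /=; rewrite in_itv/=.
have [xx|xx|->] := ltgtP x x0; last by lra.
- by have := D _ _ x01' x01 Ax' Ax xx; lra.
- by have := D _ _ x01 x01' Ax Ax' xx; lra.
Qed.

(** The traces of a cover of [X] cover the parameter interval, whose Lebesgue
    measure is 1. *)
Lemma premeasure_ge s delta : (1 < N)%N -> (0 < s)%R -> (s <= ln N%:R)%R ->
  (4^-1)%:E <= entropy_premeasure f setT layer_cover s delta.
Proof.
move=> N1 s0 sN; apply: le_ereal_inf_tmp => _ [A [AT _] <-].
have /choice[I HI] := fun j => trace_measure (A j) N1 s0 sN.
have : lebesgue_measure `[0%R, 1%R[%classic <= \sum_(0 <= j <oo) lebesgue_measure (I j).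
  apply: measure_sigma_subadditive => //.
    by move=> j; have [] := HI j.
  move=> x /=; rewrite in_itv/= => x01.
  have [j _ Ax] := AT (Z x) Logic.I.
  by exists j => //; have [_ + _] := HI j; apply.
rewrite lebesgue_measure_itv/= lte_fin ltr01 oppr0 adde0 => L1.
have L2 : \sum_(0 <= j <oo) lebesgue_measure (I j) <=
    \sum_(0 <= j <oo) (4%:E * bowen_diam R f layer_cover (A j) `^ s).
  by apply: lee_nneseries => // j _; have [] := HI j.
have := le_trans L1 L2; rewrite nneseriesZl; last by move=> j _; exact: poweR_ge0.
by rewrite -[(4^-1)%:E]mule1 lee_pdivrMl.
Qed.

Lemma cover_entropy_ge : (1 < N)%N ->
  (ln N%:R)%:E <= cover_entropy R f setT layer_cover.
Proof.
move=> N1; apply: le_ereal_inf_tmp => _ [s [s0 Hs] <-].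
rewrite lee_fin leNgt; apply/negP => sN.
have := premeasure_ge 1 N1 s0 (ltW sN); apply/negP; rewrite -ltNge.
apply: (@le_lt_trans _ _ 0); last by rewrite lte_fin invr_gt0.
by rewrite -Hs; apply: ereal_sup_ubound; exists 1%R => //=.
Qed.
End LayeredEntropy.

(** A mass distribution principle: the points [Z x] follow itineraries that
    separate their parameters at rate [N], for an arbitrary [N], since the
    layers at different times can be colored independently. The space is far
    from compact here: the orbits escape through the sets [G]. *)
Theorem entropy_of_layers (R : realType) (X : topologicalType) (f : X -> X)
    (G : R -> nat -> set X) :
  (forall x n, open (G x n)) ->
  (forall x y n, x < y -> closure (G x n) `<=` G y n) ->
  (forall n, closure (G 1 n) `<=` G 0 n.+1) ->
  (forall p, exists n, G 0 n p) ->
  (forall x, 0 <= x <= 1 -> exists p, forall n,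
     closure (G x n) (iter n f p) /\ ~ G x n (iter n f p)) ->
  topological_entropy R f = +oo%E.
Proof.
move=> oG sG nG eG zG.
have [Z0 _] := zG 0 (introT andP (conj (lexx 0) ler01)).
have /choice[Z HZ] : forall x : R, exists p, 0 <= x <= 1 -> forall n,
    closure (G x n) (iter n f p) /\ ~ G x n (iter n f p).
  move=> x; have [/zG[p Hp]|nx] := pselect (0 <= x <= 1); first by exists p.
  by exists Z0.
have ZG x n : 0 <= x <= 1 -> closure (G x n) (iter n f (Z x)) /\ ~ G x n (iter n f (Z x)).
  by move=> /HZ.
apply/eqyP => A A0.
set N := (Num.truncn (expR A)).+2.
have N1 : (1 < N)%N by [].
have AN : A <= ln N%:R.
  rewrite -[A]expRK ler_ln ?posrE ?expR_gt0 ?ltr0n//.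
  by apply/ltW/(lt_trans (truncnS_gt _)); rewrite ltr_nat.
apply: (@le_trans _ _ (ln N%:R)%:E); first by rewrite lee_fin.
apply: le_trans (cover_entropy_ge sG ZG (ltnW N1) N1) _.
apply: ereal_sup_ubound; exists (layer_cover G N) => //.
exact: finite_open_layer_cover oG sG nG eG N (ltnW N1).
Qed.

(** * The entropy of entire functions *)

(** The parameter [x] in [[0, 1]] stands for the initial radius
    [r * (1 + x / 2)], which stays below [2 * r], the radius already covered
    by the hull of the image of [disc r]. *)
Theorem entropy_entire (R : realType) (f : R[i]^o -> R[i]^o) :
  (forall z, holo f z) -> ~ (exists a b, forall z : R[i], f z = (a + b * z)%R) ->
  topological_entropy R f = +oo%E.
Proof.
move=> fh fna; have [r r0 /disc_sub_hull big] := missed_set_far fh fna.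
have grow := disc_sub_grown r0 big.
pose G (x : R) n := grown f (r * (1 + x / 2)) n.
have G0 n : G 0 n = grown f r n by rewrite /G mul0r addr0 mulr1.
have lt2 x y : x < y -> r * (1 + x / 2) < r * (1 + y / 2).
  by move=> xy; rewrite ltr_pM2l//; lra.
apply: (@entropy_of_layers R _ f G).
- by move=> x n; exact: open_grown.
- by move=> x y n /lt2; exact: grown_strict.
- move=> n; rewrite G0; apply: (@subset_trans _ (grown f (2 * r) n)).
    by apply: grown_strict => //; lra.
  by apply: grown_next; exact: big.
- move=> p; exists (Num.truncn (cmod p / r)).+1; rewrite G0; apply: grow.
  rewrite /disc/= -ltr_pdivrMr//; apply: (lt_le_trans (truncnS_gt _)).
  by rewrite -natrX ler_nat ltnW// ltn_expl.
- move=> x /andP[x0 x1]; apply: frontier_orbit => // n.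
  have xr : r <= r * (1 + x / 2) by rewrite ler_peMr ?(ltW r0)//; lra.
  apply: (grown_mono xr); apply: grow; suff : cmod (0 : R[i]) < 2 ^+ n * r by [].
  by rewrite cmod0 mulr_gt0// exprn_gt0.
Qed.

Local Open Scope ereal_scope.
Theorem theorem6p1 (R : realType) (f : R[i]^o -> R[i]^o)
  (hf : transcendental_entire f) :
  topological_entropy R f = +oo.
Proof.
have [fh fnp] := hf; apply: entropy_entire => [z|[a [b fab]]].
  exact: Holo (fh z).
apply: fnp; exists (a%:P + b *: 'X)%R => z.
by rewrite fab hornerD hornerC hornerZ hornerX.
Qed.
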